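(* $\mathcal{B}\mathcal{M}=\mathcal{B}\mathcal{C}\mathcal{S}=\mathcal{B}\mathcal{S}=\mathcal{B}\mathcal{E}=\mathcal{B}\mathcal{E}_0=\mathcal{B}\mathcal{M}_0$.
   Context: For a class $\mathcal{C}$ of topological spaces, $\mathcal{B}\mathcal{C}$ denotes the class of all Boolean algebras $A$ for which there exists $X\in\mathcal{C}$ such that $A$ is isomorphic to the Boolean algebra $RO(X)$ of regular open subsets of $X$ (those $U$ with $U=\mathrm{int}(\mathrm{cl}(U))$, ordered by inclusion). An Eberlein compact is a compact Hausdorff space homeomorphic to a weakly compact subset of a Banach space. An Eberlein space is a subspace of an Eberlein compact. Zero-dimensional means having a base of clopen sets. The classes are: $\mathcal{M}$: all metrizable spaces; $\mathcal{M}_0$: all zero-dimensional metrizable spaces; $\mathcal{E}$: all Eberlein compacts; $\mathcal{E}_0$: all zero-dimensional Eberlein compacts; $\mathcal{S}$: all spaces which have a dense Eberlein subspace; $\mathcal{C}\mathcal{S}$ (denoting a single class, to which the prefix $\mathcal{B}$ is then applied): all compact spaces which have a dense Eberlein subspace. *)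

(* Defs.v *)
From HB Require Import structures.
From mathcomp Require Import all_boot all_order all_algebra.
From mathcomp Require Import all_classical all_reals all_analysis.
Import Order.TTheory GRing.Theory Num.Theory.
Import numFieldNormedType.Exports.

Set Implicit Arguments.
Unset Strict Implicit.
Unset Printing Implicit Defensive.

Local Open Scope classical_set_scope.

Definition regular_opens (X : topologicalType) :=
  {U : set X | `[< regopen U >]}.

Fact regopen_display : Order.disp_t. Proof. exact: (Order.Disp tt tt). Qed.

Section RegularOpens.
Variable X : topologicalType.
Implicit Types U V W : set X.
Local Notation RO := (regular_opens X).
Implicit Types x y z : RO.

Lemma regopen_val x : regopen (val x).
Proof. exact/asboolP/(valP x). Qed.

Lemma regopen_val_open x : open (val x).
Proof. by rewrite -regopen_val; exact: open_interior. Qed.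

Lemma regopen_intcl U : regopen (interior (closure U)).
Proof. exact/interior_closed_regopen/closed_closure. Qed.

Lemma open_sub_intcl U : open U -> U `<=` interior (closure U).
Proof. by move=> oU; rewrite -open_subsetE//; exact: subset_closure. Qed.

Lemma closureI_open U W : open W -> closure U `&` W `<=` closure (U `&` W).
Proof.
move=> oW p [cUp Wp] B Bp; rewrite -setIA (setIC W).
have /cUp [q [Uq [Bq Wq]]] : nbhs p (B `&` W).
  by apply: filterI => //; exact: open_nbhs_nbhs.
by exists q.
Qed.

Lemma regopenI U V : regopen U -> regopen V -> regopen (U `&` V).
Proof.
move=> rU rV; rewrite /regopen eqEsubset; split.
  rewrite subsetI -[X in _ `<=` X /\ _]rU -[X in _ /\ _ `<=` X]rV.
  by split; apply/interiorS/closureS; [exact: subIsetl | exact: subIsetr].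
apply: open_sub_intcl; apply: openI.
  by rewrite -rU; exact: open_interior.
by rewrite -rV; exact: open_interior.
Qed.

Lemma regopen0 : regopen (@set0 X).
Proof. by rewrite /regopen closure0 interior0. Qed.

Lemma regopenT : regopen [set: X].
Proof. by rewrite /regopen closureT interiorT. Qed.

Definition mkRO U (rU : regopen U) : RO := exist _ U (asboolT rU).

Definition RO_bot := mkRO regopen0.
Definition RO_top := mkRO regopenT.
Definition RO_meet x y := mkRO (regopenI (regopen_val x) (regopen_val y)).
Definition RO_join x y := mkRO (regopen_intcl (val x `|` val y)).
Definition RO_compl x :=
  mkRO (interior_closed_regopen (open_closedC (regopen_val_open x))).

HB.instance Definition _ := SubChoice.on RO.

Definition RO_le x y := `[< val x `<=` val y >].

Lemma RO_leP x y : reflect (val x `<=` val y) (RO_le x y).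
Proof. exact: asboolP. Qed.

Fact RO_le_refl : reflexive RO_le.
Proof. by move=> x; exact/RO_leP. Qed.

Fact RO_le_anti : antisymmetric RO_le.
Proof.
by move=> x y /andP[/RO_leP xy /RO_leP yx]; apply/val_inj; exact/seteqP.
Qed.

Fact RO_le_trans : transitive RO_le.
Proof.
move=> y x z /RO_leP xy /RO_leP yz.
by apply/RO_leP; exact: subset_trans yz.
Qed.

HB.instance Definition _ := Order.Le_isPOrder.Build regopen_display RO
  RO_le_refl RO_le_anti RO_le_trans.

Fact RO_lexI x y z :
  (x <= RO_meet y z)%O = ((x <= y)%O && (x <= z)%O).
Proof.
apply/RO_leP/andP => [|[/RO_leP xy /RO_leP xz]]; rewrite /= subsetI //.
by move=> [xy xz]; split; exact/RO_leP.
Qed.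

Fact RO_leUx x y z :
  (RO_join x y <= z)%O = ((x <= z)%O && (y <= z)%O).
Proof.
have sJ : val x `|` val y `<=` val (RO_join x y).
  by apply: open_sub_intcl; apply: openU; exact: regopen_val_open.
apply/RO_leP/andP => [xyz|[/RO_leP xz /RO_leP yz]].
  by split; apply/RO_leP => p ?; apply/xyz/sJ; [left|right].
rewrite -[X in _ `<=` X]regopen_val.
by apply/interiorS/closureS; rewrite subUset.
Qed.

HB.instance Definition _ :=
  Order.POrder_isMeetSemilattice.Build regopen_display RO RO_lexI.
HB.instance Definition _ :=
  Order.POrder_isJoinSemilattice.Build regopen_display RO RO_leUx.

Fact RO_meetUl : left_distributive (@Order.meet _ RO) (@Order.join _ RO).
Proof.
move=> x y z; apply/le_anti/andP; split; last first.
  by rewrite leUx !leI2 ?leUl ?leUr.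
apply/RO_leP => /=; rewrite -setIUl.
rewrite -open_subsetE; last exact/openI/regopen_val_open/open_interior.
apply: subset_trans (closureI_open (regopen_val_open z)).
by apply: setSI; exact: interior_subset.
Qed.

HB.instance Definition _ :=
  Order.Lattice_Meet_isDistrLattice.Build regopen_display RO RO_meetUl.

Fact RO_le0x x : (RO_bot <= x)%O.
Proof. by apply/RO_leP; exact: sub0set. Qed.

Fact RO_lex1 x : (x <= RO_top)%O.
Proof. by apply/RO_leP; exact: subsetT. Qed.

HB.instance Definition _ :=
  Order.hasBottom.Build regopen_display RO RO_le0x.
HB.instance Definition _ :=
  Order.hasTop.Build regopen_display RO RO_lex1.

Fact RO_joinxC x : Order.join x (RO_compl x) = \top%O.
Proof.
apply/val_inj/seteqP; split=> //= p _.
suff -> : closure (val x `|` interior (~` val x)) = setT by rewrite interiorT.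
rewrite interiorC closureU; apply/seteqP; split=> // q _.
have [xq|xq] := pselect (closure (val x) q); first by left.
by right; exact: subset_closure.
Qed.

Fact RO_meetxC x : Order.meet x (RO_compl x) = \bot%O.
Proof.
apply/val_inj/seteqP; split=> //= p [xp].
by move=> /interior_subset.
Qed.

HB.instance Definition _ :=
  Order.TBDistrLattice_hasComplement.Build regopen_display RO
    RO_joinxC RO_meetxC.

End RegularOpens.

Definition boolean_isomorphic d (A : ctbDistrLatticeType d)
    d' (B : ctbDistrLatticeType d') : Prop :=
  exists f : A -> B,
    [/\ bijective f,
        {morph f : x y / Order.meet x y}, {morph f : x y / Order.join x y},
        {morph f : x / Order.compl x}
      & f \bot%O = \bot%O /\ f \top%O = \top%O].

Definition homeomorphic (X Y : topologicalType) : Prop :=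
  exists (f : X -> Y) (g : Y -> X),
    [/\ cancel f g, cancel g f, continuous f & continuous g].

(* Not the library's zero_dimensional, which only asks that clopen sets separate
   points and is weaker outside the compact case. *)
Definition zero_dim_space (X : topologicalType) : Prop :=
  exists2 B : set (set X), basis B & B `<=` @clopen X.

Section WeakTopology.
Variables (R : realType) (V : normedModType R).

Definition continuous_dual : Type :=
  {f : {linear V -> R^o} | continuous (f : V -> R^o)}.

(* A copy of V carrying the coarsest topology that makes every element of the
   dual continuous, instead of the norm topology. *)
Definition weak_space : Type :=
  sup_topology (fun f : continuous_dual =>
    Topological.class (initial_topology (sval f : V -> R^o))).

HB.instance Definition _ := Topological.on weak_space.

End WeakTopology.

Section Classes.
Variable R : realType.
Implicit Type X : topologicalType.

Definition metrizable X : Prop :=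
  exists M : metricType R, homeomorphic X M.

Definition metrizable0 X : Prop := metrizable X /\ zero_dim_space X.

Definition eberlein_compact X : Prop :=
  [/\ compact [set: X], hausdorff_space X
    & exists (V : completeNormedModType R) (K : set (weak_space V)),
        compact K /\ homeomorphic X (set_type K)].

Definition eberlein_compact0 X : Prop := eberlein_compact X /\ zero_dim_space X.

Definition eberlein_space X : Prop :=
  exists (E : topologicalType) (S : set E),
    eberlein_compact E /\ homeomorphic X (set_type S).

Definition dense_eberlein X : Prop :=
  exists D : set X, dense D /\ eberlein_space (set_type D).

Definition compact_dense_eberlein X : Prop :=
  compact [set: X] /\ dense_eberlein X.

End Classes.

Definition RO_class (C : topologicalType -> Prop)
    d (A : ctbDistrLatticeType d) : Prop :=
  exists2 X : topologicalType, C X & boolean_isomorphic A (regular_opens X).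

(* Main.v *)
(* All the Boolean algebras are shown to be regular open algebras of a space Y
   of branches of a tree with countably many levels.  In a metrizable space,
   choose for each n a maximal disjoint family of open sets of diameter at most
   1/(n+1), each refining the previous one; these families form a tree, and
   together a pi-base.  Since a regular open algebra only depends on the
   disjointness relation between the members of a pi-base, the set Y of branches,
   an ultrametric space, has the same regular open algebra.

   For a weakly compact set K, the same works with norm diameters, because
   every nonempty weakly open subset of K contains nonempty weakly open subsets of
   arbitrarily small norm diameter.  Otherwise, alternately choose points x_n and
   shrink the open set so as to avoid a closed ball around a rational combination
   of x_0, ..., x_n: a cluster point of the x_n would lie in the intersection of
   the open sets, far from all combinations, yet by Hahn-Banach in the closed span
   of the x_n.  A space with a dense Eberlein subspace has the same regular open
   algebra as the closure of that subspace in a weakly compact set.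

   Conversely, the branches, seen as subsets of the set T of nodes of the tree,
   are dense in their closure C in 2^T.  The members of C have at most one node on
   each level, so mapping x to the function t |-> 1/(level t + 1) on x, 0 elsewhere,
   embeds C in the space of bounded functions on T with its weak topology: a
   continuous functional is at least e in absolute value on only finitely many
   indicators of nodes.  So C is a zero-dimensional Eberlein compact. *)

Require Import Defs.
From mathcomp Require Import all_boot all_order all_algebra.
From mathcomp Require Import all_classical all_reals all_analysis.
From HB Require Import structures.
From mathcomp Require Import finmap ring lra.
Import Order.Theory GRing.Theory Num.Theory.
Import numFieldNormedType.Exports.

Set Implicit Arguments.
Unset Strict Implicit.
Unset Printing Implicit Defensive.

Local Open Scope classical_set_scope.

(** * Regular open algebras and pi-bases *)

Lemma order_iso_boolean_isomorphic d (A : ctbDistrLatticeType d)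
    d' (B : ctbDistrLatticeType d') (f : A -> B) (g : B -> A) :
  cancel f g -> cancel g f -> (forall x y, (f x <= f y)%O = (x <= y)%O) ->
  boolean_isomorphic A B.
Proof.
move=> fK gK fle.
have gle x y : (g x <= y)%O = (x <= f y)%O by rewrite -fle gK.
have leg x y : (x <= g y)%O = (f x <= y)%O by rewrite -fle gK.
have fI x y : f (Order.meet x y) = Order.meet (f x) (f y).
  apply/le_anti/andP; split; first by rewrite lexI !fle leIl leIr.
  by rewrite -gle lexI !gle leIl leIr.
have fU x y : f (Order.join x y) = Order.join (f x) (f y).
  apply/le_anti/andP; split; last by rewrite leUx !fle leUl leUr.
  by rewrite -leg leUx !leg leUl leUr.
have f0 : f \bot%O = \bot%O by apply/le_anti; rewrite le0x -leg le0x.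
have f1 : f \top%O = \top%O by apply/le_anti; rewrite lex1 -gle lex1.
exists f; split => //; first by exists g.
move=> x; apply/le_anti/andP; split.
  by rewrite -disj_leC -fI meetCx f0.
rewrite -gle -disj_leC.
rewrite -[X in Order.meet _ X]fK.
apply/eqP/(can_inj fK).
by rewrite f0 fI !gK meetCx.
Qed.

Lemma boolean_isomorphic_sym d (A : ctbDistrLatticeType d)
    d' (B : ctbDistrLatticeType d') :
  boolean_isomorphic A B -> boolean_isomorphic B A.
Proof.
move=> [f [[g fK gK] fI fU fC [f0 f1]]]; have fi := can_inj fK.
exists g; split; first by exists f.
- by move=> x y; apply: fi; rewrite fI !gK.
- by move=> x y; apply: fi; rewrite fU !gK.
- by move=> x; apply: fi; rewrite fC !gK.
- by split; apply: fi; rewrite gK.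
Qed.

Lemma boolean_isomorphic_trans d (A : ctbDistrLatticeType d)
    d' (B : ctbDistrLatticeType d') e (C : ctbDistrLatticeType e) :
  boolean_isomorphic A B -> boolean_isomorphic B C -> boolean_isomorphic A C.
Proof.
move=> [f [bf fI fU fC [f0 f1]]] [g [bg gI gU gC [g0 g1]]].
exists (g \o f); split; first exact: bij_comp.
- by move=> x y /=; rewrite fI gI.
- by move=> x y /=; rewrite fU gU.
- by move=> x /=; rewrite fC gC.
- by rewrite /= f0 f1.
Qed.

Lemma RO_class_transport (C C' : topologicalType -> Prop) d
    (A : ctbDistrLatticeType d) :
  (forall X, C X -> exists2 Y, C' Y &
     boolean_isomorphic (regular_opens X) (regular_opens Y)) ->
  RO_class C A -> RO_class C' A.
Proof.
move=> CC' [X /CC'[Y C'Y XY] AX].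
by exists Y => //; exact: boolean_isomorphic_trans XY.
Qed.

(** Members are indexed so that pi-bases of two spaces can be matched index by index; some of them
    may be empty. *)
Definition pi_base (X : topologicalType) (T : Type) (u : T -> set X) :=
  (forall t, open (u t)) /\
  (forall O, open O -> O !=set0 -> exists2 t, u t !=set0 & u t `<=` O).

Section PiBase.
Variables (X : topologicalType) (T : Type) (u : T -> set X).
Hypothesis upi : pi_base u.

(** Each neighbourhood of a point of [W] contains a nonempty member lying in [W], hence in [W']. So
    [W] lies in the closure of [W'], and regularity of [W'] concludes. *)
Lemma pi_base_sub_regopen (W W' : set X) : open W -> regopen W' ->
  (forall t, u t `<=` W -> u t `<=` W') -> W `<=` W'.
Proof.
move=> oW rW' WW'; rewrite -[X in _ `<=` X]rW' -open_subsetE// => x Wx N.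
rewrite nbhsE => -[N' [oN' N'x] N'N].
have [t [y uty] utN] : exists2 t, u t !=set0 & u t `<=` N' `&` W.
  by apply: upi.2; [exact: openI | exists x].
exists y; split; last exact/N'N/(utN _ uty).1.
by apply: WW' uty; apply: subset_trans utN _; exact: subIsetr.
Qed.

(** Inclusion in a regular open set is read off from disjointness alone: if [u t] were not inside
    [W], some nonempty member within [u t] would miss [W]. *)
Lemma pi_base_sub_regopenP (W : set X) t : regopen W ->
  u t `<=` W <-> forall s, u s `&` W = set0 -> u t `&` u s = set0.
Proof.
move=> rW; split=> [tW s sW|h].
  by apply/seteqP; split=> // x [utx usx]; rewrite -sW; split => //; exact: tW.
apply: (pi_base_sub_regopen (upi.1 t) rW) => s st.
rewrite -[X in _ `<=` X]rW -open_subsetE; last exact: upi.1.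
move=> x usx N; rewrite nbhsE => -[N' [oN' N'x] N'N].
apply: contrapT => WN0.
have [r [y ury] urN] : exists2 r, u r !=set0 & u r `<=` N' `&` u s.
  by apply: upi.2; [apply: openI => //; exact: upi.1 | exists x].
suff : (u t `&` u r) y.
  rewrite h // -subset0 => z [urz Wz]; apply: WN0; exists z; split=> //.
  exact/N'N/(urN _ urz).1.
by split => //; exact/st/(urN _ ury).2.
Qed.

End PiBase.

Section PiBaseIso.
Variables (X Y : topologicalType) (T : Type) (u : T -> set X) (v : T -> set Y).

(** The outer closure and interior make the value regular open for arbitrary [v]. Once the [v s] are
    open the intersection is closed, and they change nothing. *)
Definition pi_base_transfer (W : regular_opens X) : regular_opens Y :=
  mkRO (regopen_intcl
    (interior (\bigcap_(s in [set s | u s `&` val W = set0]) ~` v s))).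

End PiBaseIso.

Section PiBaseIsoTheory.
Variables (X Y : topologicalType) (T : Type) (u : T -> set X) (v : T -> set Y).
Hypotheses (upi : pi_base u) (vpi : pi_base v).
Hypothesis uv : forall s t, u s `&` u t = set0 <-> v s `&` v t = set0.

Lemma pi_base_transferP W t :
  v t `<=` val (pi_base_transfer u v W) <-> u t `<=` val W.
Proof.
have cB : closed (\bigcap_(s in [set s | u s `&` val W = set0]) ~` v s).
  by apply: closed_bigI => s _; apply: open_closedC; exact: vpi.1.
have -> : val (pi_base_transfer u v W) =
    interior (\bigcap_(s in [set s | u s `&` val W = set0]) ~` v s).
  exact: interior_closed_regopen.
rewrite -open_subsetE; last exact: vpi.1.
rewrite (pi_base_sub_regopenP upi _ (regopen_val W)); split=> h.
  move=> s sW; apply/uv/seteqP; split=> // x [vtx vsx].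
  exact: h vtx _ sW vsx.
by move=> x vtx s /h /uv h0 vsx; rewrite -[False]/(@set0 Y x) -h0.
Qed.

End PiBaseIsoTheory.

(** A regular open set is determined by the indices of the members it contains, and the transfer
    keeps these indices. So the two transfers are inverse order isomorphisms. *)
Theorem pi_base_regular_opens (X Y : topologicalType) (T : Type)
    (u : T -> set X) (v : T -> set Y) :
  pi_base u -> pi_base v ->
  (forall s t, u s `&` u t = set0 <-> v s `&` v t = set0) ->
  boolean_isomorphic (regular_opens X) (regular_opens Y).
Proof.
move=> upi vpi uv; have vu s t : v s `&` v t = set0 <-> u s `&` u t = set0.
  by split=> /uv.
have le (Z : topologicalType) (w : T -> set Z) (W W' : regular_opens Z) :
    pi_base w ->
    (W <= W')%O <-> (forall t, w t `<=` val W -> w t `<=` val W').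
  move=> wpi; split=> [/RO_leP WW' t /subset_trans|h]; first exact.
  apply/RO_leP.
  exact: (pi_base_sub_regopen wpi (regopen_val_open W) (regopen_val W') h).
pose F := @pi_base_transfer X Y T u v; pose G := @pi_base_transfer Y X T v u.
apply: (@order_iso_boolean_isomorphic _ _ _ _ F G).
- move=> W; apply/le_anti/andP; split; apply: (iffRL (le _ u _ _ upi)) => t;
    by rewrite (pi_base_transferP vpi upi vu) (pi_base_transferP upi vpi uv).
- move=> W; apply/le_anti/andP; split; apply: (iffRL (le _ v _ _ vpi)) => t;
    by rewrite (pi_base_transferP upi vpi uv) (pi_base_transferP vpi upi vu).
- move=> W W'; apply/idP/idP.
    move=> /(iffLR (le _ v _ _ vpi)) h; apply: (iffRL (le _ u _ _ upi)) => t.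
    by rewrite -!(pi_base_transferP upi vpi uv); exact: h.
  move=> /(iffLR (le _ u _ _ upi)) h; apply: (iffRL (le _ v _ _ vpi)) => t.
  by rewrite !(pi_base_transferP upi vpi uv); exact: h.
Qed.

Definition dense_embedding (Y X : topologicalType) (e : Y -> X) :=
  [/\ continuous e, dense (range e) &
      forall O, open O -> exists2 O', open O' & O = e @^-1` O'].

(** The pi-bases are all open sets of [X] and their preimages; by density a nonempty open set has a
    nonempty preimage, so disjointness is the same on both sides. *)
Lemma dense_embedding_regular_opens (Y X : topologicalType) (e : Y -> X) :
  dense_embedding e ->
  boolean_isomorphic (regular_opens X) (regular_opens Y).
Proof.
move=> [ce de ie].
have e0 O : open O -> (O = set0) <-> (e @^-1` O = set0).
  move=> oO; split=> [->|]; first by rewrite preimage_set0.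
  apply: contraPP => /eqP/set0P O0 /seteqP[h _].
  by have [x [Ox [y _ ey]]] := de _ O0 oO; apply: (h y); rewrite /= ey.
apply: (@pi_base_regular_opens _ _ {O : set X | open O} sval
  (fun O => e @^-1` sval O)).
- split; first by case.
  by move=> O oO O0; exists (exist _ O oO).
- split=> [[U oU]|O oO O0]; first by move/continuousP : ce; exact.
  have [U oU OU] := ie _ oO.
  by exists (exist _ U oU) => /=; rewrite -OU.
- by move=> [U oU] [W oW] /=; rewrite -preimage_setI; apply: e0; exact: openI.
Qed.

(** * Ultrametric spaces of sequences *)

(* The parameter R only fixes the field in which the distance takes its
   values. *)
Definition sequence_space (R : realType) (I : Type) (P : set (nat -> I)) : Type :=
  {b : nat -> I | P b}.

Section SequenceSpace.
Local Open Scope ring_scope.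
Variables (R : realType) (I : Type) (P : set (nat -> I)).
Local Notation Y := (sequence_space R P).
Implicit Types b c : Y.

(** The gaps decrease with [n], so their supremum is given by the first difference; the element 0
    keeps the set nonempty when the sequences agree. *)
Definition seq_gaps b c : set R :=
  [set r | r = 0 \/ exists2 n, sval b n <> sval c n & r = n.+1%:R^-1].

Definition seq_dist b c : R := sup (seq_gaps b c).

Lemma seq_gaps_sup b c : has_sup (seq_gaps b c).
Proof.
split; first by exists 0; left.
exists 1 => _ [->//|[n _ ->]].
by rewrite invf_le1// ler1n.
Qed.

Lemma seq_dist_gap b c n : sval b n <> sval c n -> n.+1%:R^-1 <= seq_dist b c.
Proof.
by move=> bc; apply: ub_le_sup; [exact: (seq_gaps_sup b c).2|right; exists n].
Qed.

Lemma seq_dist_ge0 b c : 0 <= seq_dist b c.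
Proof. by apply: ub_le_sup; [exact: (seq_gaps_sup b c).2|left]. Qed.

Lemma seq_dist_le b c (e : R) : 0 <= e ->
  (forall n, sval b n <> sval c n -> n.+1%:R^-1 <= e) -> seq_dist b c <= e.
Proof.
move=> e0 h; apply: ge_sup; first exact: (seq_gaps_sup b c).1.
by move=> _ [->//|[n bc ->]]; exact: h.
Qed.

Lemma seq_distxx b : seq_dist b b = 0.
Proof. by apply/le_anti; rewrite seq_dist_ge0 seq_dist_le. Qed.

Lemma seq_dist_positivity b c : seq_dist b c = 0 -> b = c.
Proof.
case: b c => b Pb [c Pc] bc0; apply: eq_exist; apply/funext => n.
by apply: contrapT => /(@seq_dist_gap (exist _ b Pb) (exist _ c Pc));
  rewrite bc0 leNgt invr_gt0 ltr0n.
Qed.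

Lemma seq_dist_sym b c : seq_dist b c = seq_dist c b.
Proof.
by apply/le_anti/andP; split; apply: seq_dist_le; rewrite ?seq_dist_ge0// => n h;
  apply: seq_dist_gap => /esym.
Qed.

Lemma seq_dist_triangle c b d : seq_dist b d <= seq_dist b c + seq_dist c d.
Proof.
apply: seq_dist_le; first by rewrite addr_ge0// seq_dist_ge0.
move=> n bd; have [bc|/seq_dist_gap bc] := pselect (sval b n = sval c n).
  by rewrite (le_trans (@seq_dist_gap c d n _)) ?lerDr ?seq_dist_ge0// -bc.
by rewrite (le_trans bc)// lerDl seq_dist_ge0.
Qed.

HB.instance Definition _ := gen_eqMixin Y.
HB.instance Definition _ := gen_choiceMixin Y.
HB.instance Definition _ := isMetric.Build R Y
  seq_distxx seq_dist_positivity seq_dist_sym seq_dist_triangle.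

Definition cylinder n b : set Y :=
  [set c | forall i, (i <= n)%N -> sval b i = sval c i].

Lemma seq_ballE b c (e : R) : ball b e c = (seq_dist b c < e).
Proof. by rewrite ballEmdist. Qed.

Lemma cylinder_ball n b : cylinder n b = ball b (n.+1%:R^-1 : R).
Proof.
apply/seteqP; split=> c; last first.
  rewrite /= seq_ballE => bc i ni; apply: contrapT => /seq_dist_gap.
  rewrite leNgt => /negP; apply; apply: (lt_le_trans bc).
  by rewrite lef_pV2 ?posrE ?ltr0n// ler_nat.
(* Sequences agreeing up to [n] first differ at [n.+1] or later, so their distance is at most
   [n.+2%:R^-1], which gives the strict inequality. *)
move=> bc; rewrite /= seq_ballE; apply: (@le_lt_trans _ _ (n.+2%:R^-1)).
  apply: seq_dist_le; first by rewrite invr_ge0.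
  move=> i bci; rewrite lef_pV2 ?posrE ?ltr0n// ler_nat ltnS ltnNge.
  by apply/negP => /bc.
by rewrite ltf_pV2 ?posrE ?ltr0n// ltr_nat.
Qed.

Lemma nbhs_cylinder n b : nbhs b (cylinder n b).
Proof. by rewrite cylinder_ball; apply: nbhsx_ballx; rewrite invr_gt0. Qed.

Lemma nbhs_cylinderP b (U : set Y) : nbhs b U -> exists n, cylinder n b `<=` U.
Proof.
move=> /nbhs_ballP[e /= e0 eU].
exists (Num.truncn e^-1); apply: subset_trans eU.
rewrite cylinder_ball; apply: le_ball.
rewrite -[leRHS]invrK lef_pV2 ?posrE ?invr_gt0 ?ltr0n//.
exact/ltW/truncnS_gt.
Qed.

Lemma cylinder_eq n b c : cylinder n b c -> cylinder n b = cylinder n c.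
Proof.
by move=> bc; apply/seteqP; split=> d h i ni; rewrite -h// bc.
Qed.

Lemma cylinder_clopen n b : clopen (cylinder n b).
Proof.
have oC c : open (cylinder n c).
  rewrite openE => d cd; rewrite /interior (cylinder_eq cd).
  exact: nbhs_cylinder.
split=> //; rewrite -[X in closed X]setCK; apply: open_closedC.
rewrite openE => c bc; apply: filterS (nbhs_cylinder n c) => d cd bd.
by apply: bc; rewrite (cylinder_eq bd); move=> i ni; rewrite (cd _ ni).
Qed.

Lemma cylinder_pi_base :
  pi_base (fun t : nat * Y => cylinder t.1 t.2).
Proof.
split=> [t|U oU [b Ub]]; first exact: (cylinder_clopen _ _).1.
have [n nU] := nbhs_cylinderP (open_nbhs_nbhs (conj oU Ub)).
by exists (n, b) => //; exists b.
Qed.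

Lemma sequence_space_metrizable0 : metrizable0 R Y.
Proof.
split; first by exists Y, id, id; split => // x; exact: cvg_id.
exists [set cylinder t.1 t.2 | t in [set: nat * Y]]; last first.
  by move=> _ [t _ <-]; exact: cylinder_clopen.
split=> [_ [t _ <-]|b U]; first exact: (cylinder_clopen _ _).1.
move=> /nbhs_cylinderP[n nU]; exists (cylinder n b) => //.
by split=> //; exists (n, b).
Qed.

End SequenceSpace.

(** * Trees of open sets *)

(** Maximality makes the union of [F] dense in [W]: an open set meeting [W] but no member of [F]
    would contain a set that could be added to [F]. *)
Lemma maximal_disjoint_opens (X : topologicalType) (S : set X -> Prop)
    (W : set X) :
  open W ->
  (forall U, open U -> U !=set0 ->
     exists U', [/\ open U', U' !=set0, U' `<=` U & S U']) ->
  exists F : set (set X),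
    [/\ (forall U, F U -> [/\ open U, U !=set0, U `<=` W & S U]),
        trivIset F id
      & forall U, open U -> U `&` W !=set0 ->
          exists2 U', F U' & U' `&` U !=set0].
Proof.
move=> oW hS.
pose D := [set U : set X | [/\ open U, U !=set0, U `<=` W & S U]].
have [F [FD tF maxF]] := ex_maximal_disjoint_subcollection id D.
exists F; split=> // U oU UW0.
have [V [oV V0 VUW SV]] := hS _ (openI oU oW) UW0.
apply: contrapT => FU0.
have FV0 U' : F U' -> ~ (U' `&` V !=set0).
  move=> FU' [x [U'x Vx]]; apply: FU0; exists U' => //; exists x.
  by split => //; exact: (VUW _ Vx).1.
have nFV : ~ F V.
  by move=> FV; apply: (FV0 _ FV); rewrite setIid.
apply: (maxF (V |` F)).
- split; first by move=> U' FU'; right.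
  by move=> h; apply/nFV/h; left.
- move=> _ [->|/FD//]; split => //; apply: subset_trans VUW _.
  exact: subIsetr.
- move=> U1 U2 [->|FU1] [->|FU2] //.
  + by rewrite setIC => /(FV0 _ FU2).
  + by move=> /(FV0 _ FU1).
  + exact: tF.
Qed.

Section Branches.
Variables (X : topologicalType) (S : nat -> set X -> Prop).
Hypothesis S_small : forall U, open U -> U !=set0 ->
  exists n U', [/\ open U', U' !=set0 &
    forall W, S n W -> W `&` U' !=set0 -> W `<=` U].

(* fam n W is the set of children at level n of a node W. *)
Variable fam : nat -> set X -> set (set X).
Hypothesis fam_sub : forall n W, open W ->
  forall U, fam n W U -> [/\ open U, U !=set0, U `<=` W & S n U].
Hypothesis fam_disj : forall n W, open W -> trivIset (fam n W) id.
Hypothesis fam_max : forall n W, open W ->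
  forall U, open U -> U `&` W !=set0 ->
    exists2 U', fam n W U' & U' `&` U !=set0.

Definition parent (b : nat -> set X) n : set X :=
  if n is m.+1 then b m else setT.

Definition branch : set (nat -> set X) :=
  [set b | forall n, fam n (parent b n) (b n)].

Lemma branch_node b : branch b -> forall n, open (b n) /\ b n !=set0.
Proof.
move=> bb; elim=> [|n [on _]].
  by have [] := fam_sub openT (bb 0).
by have [] := fam_sub on (bb n.+1).
Qed.

Lemma branch_parent_open b : branch b -> forall n, open (parent b n).
Proof. by move=> bb [|n] /=; [exact: openT|exact: (branch_node bb n).1]. Qed.

Lemma branch_small b n : branch b -> S n (b n).
Proof. by move=> bb; have [] := fam_sub (branch_parent_open bb n) (bb n). Qed.

Lemma branch_decr b m n : branch b -> (m <= n)%N -> b n `<=` b m.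
Proof.
move=> bb; elim: n => [|n IHn]; first by rewrite leqn0 => /eqP->.
rewrite leq_eqVlt => /predU1P[->//|/IHn]; apply: subset_trans.
by have [] := fam_sub (branch_parent_open bb n.+1) (bb n.+1).
Qed.

(** By induction on the level: [b i] and [c i] have the same parent and share the common point, and
    siblings are disjoint. *)
Lemma branch_meet_eq b c n : branch b -> branch c -> b n `&` c n !=set0 ->
  forall i, (i <= n)%N -> b i = c i.
Proof.
move=> bb bc [x [bnx cnx]]; elim=> [_|i IHi iltn].
  apply: (fam_disj openT (bb 0) (bc 0)).
  by exists x; split; [exact: branch_decr bnx|exact: branch_decr cnx].
have oi := branch_parent_open bb i.+1.
have cib : fam i.+1 (parent b i.+1) (c i.+1).
  by rewrite /= (IHi (ltnW iltn)); exact: (bc i.+1).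
apply: (fam_disj oi (bb i.+1) cib).
by exists x; split; [exact: branch_decr bnx|exact: branch_decr cnx].
Qed.

Lemma branch_extend n (c : nat -> set X) :
  (forall i, (i <= n)%N -> fam i (parent c i) (c i)) ->
  exists2 b, branch b & forall i, (i <= n)%N -> b i = c i.
Proof.
move=> hc.
pose nxt m w : set X := get (fam m w).
(* The sequence follows [c] up to level [n], then picks arbitrary children; the final [c 0] is never
   reached because [0 <= n]. *)
pose fix b i : set X := if (i <= n)%N then c i else
  if i is j.+1 then nxt j.+1 (b j) else c 0.
have bc i : (i <= n)%N -> b i = c i by case: i => [|i] //= ->.
exists b => // i.
suff : fam i (parent b i) (b i) /\ (open (b i) /\ b i !=set0) by case.
elim: i => [|i [_ [oi i0]]].
  have f0 : fam 0 (parent b 0) (b 0) by rewrite bc//; exact: (hc 0).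
  by split => //; have [] := fam_sub openT f0.
suff fi : fam i.+1 (b i) (b i.+1) by split => //; have [] := fam_sub oi fi.
have [iltn|nlei] := leqP i.+1 n.
  by rewrite !bc// ?(ltnW iltn)//; exact: (hc i.+1).
rewrite [b i.+1]/= leqNgt nlei /=; apply: getPex.
have [|U fU _] := fam_max i.+1 oi openT; first by rewrite setTI.
by exists U.
Qed.

(** The nodes of each level have dense union: if [b n] meets [U], then by [fam_max] so does one of
    its children, and the prefix ending there extends to a branch. *)
Lemma branch_meets n U : open U -> U !=set0 ->
  exists2 b, branch b & b n `&` U !=set0.
Proof.
move=> oU U0; elim: n => [|n [b bb bU0]].
  have [|V fV VU0] := fam_max 0 openT oU; first by rewrite setIT.
  have [|b bb bV] := @branch_extend 0 (fun=> V).
    by move=> i; rewrite leqn0 => /eqP->.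
  by exists b => //; rewrite bV.
have [|V fV VU0] := fam_max n.+1 (branch_node bb n).1 oU; first by rewrite setIC.
have [|c bc cV] := @branch_extend n.+1 (fun i => if (i <= n)%N then b i else V).
  move=> i; rewrite leq_eqVlt => /predU1P[->|]; first by rewrite /= leqnn ltnn.
  rewrite ltnS => ilen; rewrite ilen.
  by case: i ilen => [|i] ilen /=; rewrite ?(ltnW ilen); exact: bb.
by exists c => //; rewrite cV// ltnn.
Qed.

Lemma branch_pi_base (R : realType) :
  pi_base (fun t : nat * sequence_space R branch => sval t.2 t.1).
Proof.
split=> [[n [b bb]]|U oU U0]; first exact: (branch_node bb n).1.
have [n [V [oV V0 hV]]] := S_small oU U0.
have [b bb bV0] := branch_meets n oV V0.
exists (n, exist _ b bb) => /=; first exact: (branch_node bb n).2.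
by apply: hV => //; exact: branch_small.
Qed.

(** The node [b n] is matched with the cylinder of level [n] around [b]. If two nodes meet, the
    branch of the deeper one passes through both; a branch in both cylinders has a nonempty node
    inside both. *)
Lemma branch_regular_opens (R : realType) :
  boolean_isomorphic (regular_opens X)
    (regular_opens (sequence_space R branch)).
Proof.
apply: (pi_base_regular_opens (@branch_pi_base R)
  (@cylinder_pi_base R _ branch)) => -[m [b bb]] [n [c bc]] /=.
suff : (b m `&` c n !=set0) <->
  (cylinder m (exist _ b bb : sequence_space R branch) `&`
   cylinder n (exist _ c bc : sequence_space R branch) !=set0).
  move=> h; split; apply: contraPP => /eqP/set0P; first by move=> /h/set0P/eqP.
  by move=> /h/set0P/eqP.
split; last first.
  move=> [[d bd] [/= bmd cnd]].
  have [x dx] := (branch_node bd (maxn m n)).2.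
  exists x; split; [rewrite (bmd m (leqnn m) : b m = d m)
                   |rewrite (cnd n (leqnn n) : c n = d n)].
    by apply: branch_decr dx => //; exact: leq_maxl.
  by apply: branch_decr dx => //; exact: leq_maxr.
wlog mn : m n b c bb bc / (m <= n)%N.
  move=> h; have [|/ltnW] := leqP m n; first exact: h.
  by move=> nm; rewrite setIC => /(h _ _ _ _ bc bb nm); rewrite setIC.
move=> [x [bmx cnx]].
have bcm : b m `&` c m !=set0.
  by exists x; split => //; exact: branch_decr cnx.
exists (exist _ c bc); split => // i im /=.
exact: branch_meet_eq bcm _ im.
Qed.

End Branches.

(** [S n U] abstracts a bound on the diameter of [U], for a metric or for a norm. The first
    hypothesis builds the tree; the second makes its nodes a pi-base. *)
Theorem dense_small_opens_sequence_space (R : realType) (X : topologicalType)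
    (S : nat -> set X -> Prop) :
  (forall n U, open U -> U !=set0 ->
     exists U', [/\ open U', U' !=set0, U' `<=` U & S n U']) ->
  (forall U, open U -> U !=set0 ->
     exists n U', [/\ open U', U' !=set0 &
       forall W, S n W -> W `&` U' !=set0 -> W `<=` U]) ->
  exists P : set (nat -> set X), boolean_isomorphic (regular_opens X)
    (regular_opens (sequence_space R P)).
Proof.
move=> hdense hsmall.
have /choice[F hF] (nW : nat * set X) : exists F : set (set X), open nW.2 ->
    [/\ (forall U, F U -> [/\ open U, U !=set0, U `<=` nW.2 & S nW.1 U]),
        trivIset F id
      & forall U, open U -> U `&` nW.2 !=set0 ->
          exists2 U', F U' & U' `&` U !=set0].
  have [oW|] := pselect (open nW.2); last by exists set0.
  by have [F hF] := maximal_disjoint_opens oW (hdense nW.1); exists F.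
exists (branch (fun n W => F (n, W))).
apply: (branch_regular_opens hsmall) => n W /(hF (n, W))[]//.
Qed.

(** * Bounded functions with the supremum norm *)

Section BoundedFunctions.
Local Open Scope ring_scope.
Variables (R : realType) (T : pointedType).

Definition bounded_real : {pred T -> R} :=
  [pred f | `[< exists M, forall t, `|f t| <= M >]].

Lemma bounded_real_submod_closed : submod_closed bounded_real.
Proof.
split; first by apply/asboolP; exists 0 => t; rewrite normr0.
move=> a f g /asboolP[M fM] /asboolP[N gN]; apply/asboolP.
exists (`|a| * M + N) => t.
by rewrite (le_trans (ler_normD _ _))// lerD// normrM ler_wpM2l.
Qed.

HB.instance Definition _ :=
  GRing.isSubmodClosed.Build R (T -> R) bounded_real bounded_real_submod_closed.

Definition linf : Type := {f : T -> R | f \in bounded_real}.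

HB.instance Definition _ := SubChoice.on linf.
HB.instance Definition _ := [SubChoice_isSubLmodule of linf by <:].

Implicit Types f g : linf.

(** As [T] is pointed, this is the supremum of a nonempty bounded set. *)
Definition linf_norm f : R := sup (range (fun t => `|val f t|)).

Lemma linf_sup f : has_sup (range (fun t => `|val f t|)).
Proof.
split; first by exists `|val f point|, point.
by have /asboolP[M fM] := valP f; exists M => _ [t _ <-].
Qed.

Lemma linf_norm_ge f t : `|val f t| <= linf_norm f.
Proof. by apply: ub_le_sup; [exact: (linf_sup f).2|exists t]. Qed.

Lemma linf_norm_le f M : (forall t, `|val f t| <= M) -> linf_norm f <= M.
Proof.
by move=> fM; apply: ge_sup; [exact: (linf_sup f).1|move=> _ [t _ <-]].
Qed.

Lemma linf_normD f g : linf_norm (f + g) <= linf_norm f + linf_norm g.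
Proof.
apply: linf_norm_le => t; rewrite raddfD /=.
by rewrite (le_trans (ler_normD _ _))// lerD// linf_norm_ge.
Qed.

Lemma linf_norm0 f : linf_norm f = 0 -> f = 0.
Proof.
move=> f0; apply/val_inj/funext => t; rewrite raddf0 /=.
by apply/normr0_eq0/le_anti; rewrite normr_ge0 -f0 linf_norm_ge.
Qed.

Lemma linf_normZ a f : linf_norm (a *: f) = `|a| * linf_norm f.
Proof.
have le b h : linf_norm (b *: h) <= `|b| * linf_norm h.
  apply: linf_norm_le => t; rewrite linearZ /= normrM.
  by rewrite ler_wpM2l// linf_norm_ge.
apply/le_anti; rewrite le /=.
have [->|a0] := eqVneq a 0.
  rewrite normr0 mul0r (le_trans _ (linf_norm_ge _ point))//.
by rewrite -ler_pdivlMl ?normr_gt0// -normfV -[X in linf_norm X <= _](scalerK a0).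
Qed.

HB.instance Definition _ :=
  Lmodule_isNormed.Build R linf linf_normD linf_normZ linf_norm0.

Lemma linf_eval_le f t : `|val f t| <= `|f|.
Proof. exact: linf_norm_ge. Qed.

Lemma linf_le f M : (forall t, `|val f t| <= M) -> `|f| <= M.
Proof. exact: linf_norm_le. Qed.

(** The limit is taken pointwise. Closed balls of the reals being closed, a Cauchy estimate passes
    to the limit with the same [e] at every point, so the convergence is uniform. *)
Lemma linf_complete (F : set_system linf) : ProperFilter F -> cauchy F -> cvg F.
Proof.
move=> FF /cauchyP Fc.
have evc t : cvg ((fun f : linf => val f t : R^o) @ F).
  apply: R_complete; apply/cauchyP => e e0; have [f Ff] := Fc e e0.
  exists (val f t).
  suff : F [set g : linf | ball (val f t : R^o) e (val g t)] by [].
  apply: filterS Ff => g.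
  rewrite -!ball_normE /= -[val f t - val g t]/((val f - val g) t) -raddfB.
  exact/le_lt_trans/linf_eval_le.
pose l t : R := lim ((fun f : linf => val f t : R^o) @ F).
have Fl e f t : 0 < e -> F (ball f e) -> `|val f t - l t| <= e.
  move=> e0 Ff.
  apply: (@closed_cvg _ _ F _ (fun g : linf => val g t : R^o)
    [set r : R^o | `|val f t - r| <= e]); last exact: evc.
  - rewrite (_ : [set _ | _] = closed_ball_ (fun x => `|x|) (val f t : R^o) e)//.
    exact: closed_closed_ball_.
  - apply: filterS Ff => g; rewrite -ball_normE /= => fg; apply/ltW.
    rewrite -[val f t - val g t]/((val f - val g) t) -raddfB.
    exact: le_lt_trans (linf_eval_le _ _) fg.
have lb : l \in bounded_real.
  have [f Ff] := Fc _ ltr01; apply/asboolP; exists (`|f| + 1) => t.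
  rewrite -[l t](subrK (val f t)) addrC (le_trans (ler_normD _ _))//.
  by rewrite lerD ?linf_eval_le// distrC Fl.
apply/cvg_ex; exists (exist _ l lb : linf).
apply/cvgrPdist_le => e e0.
have [f Ff] := Fc (e / 2) (divr_gt0 e0 (ltr0Sn R 1)).
apply: filterS (Ff) => g; rewrite -ball_normE /= => fg.
rewrite distrC -(subrKA f) (le_trans (ler_normD _ _))// [leRHS]splitr lerD//.
  by rewrite distrC ltW.
by apply: linf_le => t; rewrite raddfB; apply: Fl => //; rewrite divr_gt0.
Qed.

HB.instance Definition _ := Uniform_isComplete.Build linf linf_complete.

(** An unbounded function is sent to 0; the functions used below are all bounded by 1. *)
Definition linf_of (h : T -> R) : linf := insubd (0 : linf) h.

Lemma linf_ofE (h : T -> R) t :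
  (forall s, `|h s| <= 1) -> val (linf_of h) t = h t.
Proof. by move=> h1; rewrite val_insubd ifT//; apply/asboolP; exists 1. Qed.

Lemma linf_of_le (h : T -> R) e :
  e <= 1 -> (forall s, `|h s| <= e) -> `|linf_of h| <= e.
Proof.
move=> e1 he; apply: linf_le => t; rewrite linf_ofE// => s.
exact: le_trans (he s) e1.
Qed.

Definition linf_unit (t : T) : linf := linf_of (fun s => (s == t)%:R).

Lemma linf_unitE t s : val (linf_unit t) s = (s == t)%:R.
Proof. by rewrite linf_ofE// => r; case: eqP => _; rewrite ?normr1 ?normr0. Qed.

Lemma linf_linear_ev t : linear (fun f => val f t : R^o).
Proof. by []. Qed.

Definition linf_ev (t : T) (f : linf) : R^o := val f t.

HB.instance Definition _ t :=
  GRing.isLinear.Build R linf R^o *:%R (linf_ev t) (linf_linear_ev t).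

Lemma linf_ev_continuous t : continuous (linf_ev t).
Proof.
apply/linear_bounded_continuous/linear_boundedP.
near=> r => f; rewrite (le_trans (linf_eval_le f t))// ler_peMl//.
Unshelve. all: by end_near. Qed.

Lemma linf_ext f g : (forall t, linf_ev t f = linf_ev t g) -> f = g.
Proof. by move=> fg; apply/val_inj/funext. Qed.

Lemma linf_sumE (D : seq T) (c : T -> R) s : uniq D ->
  linf_ev s (\sum_(t <- D) c t *: linf_unit t) = if s \in D then c s else 0.
Proof.
elim: D => [_|t D IHD /= /andP[tD uD]]; first by rewrite big_nil linear0.
rewrite big_cons linearP /= IHD// /linf_ev linf_unitE inE.
have [->|st] := eqVneq s t; last by rewrite scaler0 add0r.
by rewrite (negbTE tD) addr0 [LHS]mulr1.
Qed.

Lemma linear_bounded_pos (V W : normedModType R) (g : {linear V -> W}) :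
  continuous g -> exists2 M, 0 < M & forall x, `|g x| <= M * `|x|.
Proof.
move=> /linear_bounded_continuous/linear_boundedP/pinfty_ex_gt0[M M0 gM].
by exists M.
Qed.

(* Evaluate g at a sum of units with signs: the sum has norm at most 1. *)
Lemma linf_units_weakly_null (g : {linear linf -> R^o}) (e : R) : continuous g ->
  0 < e -> finite_set [set t | e <= `|g (linf_unit t)|].
Proof.
move=> /linear_bounded_pos[M M0 gM] e0; apply: contrapT => Ainf.
have [D DA ND] := infinite_set_fset (Num.truncn (M / e)).+1 Ainf.
pose c t : R := Num.sg (g (linf_unit t)).
pose v := \sum_(t <- D) c t *: linf_unit t.
have v1 : `|v| <= 1.
  apply: linf_le => s; rewrite -[val v s]/(linf_ev s v) linf_sumE ?fset_uniq//.
  by case: ifP => _; rewrite ?normr0// /c normr_sg; case: eqP.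
have gv : g v = \sum_(t <- D) `|g (linf_unit t)|.
  rewrite linear_sum; apply: eq_bigr => t _.
  by rewrite linearZ /= normrEsg.
have : \sum_(t <- D) e <= M.
  rewrite (@le_trans _ _ (g v))//.
    rewrite gv [leLHS]big_seq [leRHS]big_seq; apply: ler_sum => t tD.
    exact: DA.
  rewrite (le_trans (ler_norm _))// (le_trans (gM v))//.
  by rewrite ger_pMr.
rewrite big_const_seq count_predT iter_addr_0 -mulr_natr -ler_pdivlMl// leNgt.
rewrite mulrC; move/negP; apply; apply: lt_le_trans (truncnS_gt _) _.
by rewrite ler_nat.
Qed.

End BoundedFunctions.

(** * Spaces of sequences as dense subspaces of Eberlein compacts *)

(** Weak topologies and product topologies are both suprema of initial topologies, so one universal
    property serves for both. *)
Lemma sup_initial_continuous (X : topologicalType) (V : choiceType) (J : Type)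
    (Z : J -> topologicalType) (p : forall j, V -> Z j) (f : X -> V) :
  continuous (f : X -> sup_topology (fun j =>
    Topological.class (initial_topology (p j)))) <->
  forall j, continuous (p j \o f).
Proof.
split=> [cf j x A fxA|cf x].
  pose S := sup_topology (fun j => Topological.class (initial_topology (p j))).
  have /cvg_sup/(_ j) cj : nbhs (f x : S) --> (f x : S) by exact: cvg_id.
  apply: (cf x (p j @^-1` A)); apply: (cj (p j @^-1` A)).
  exact: initial_continuous.
apply/cvg_sup => j A [_ [[U oU <-] Ufx] sub].
apply: filterS sub _; apply: (cf j x).
exact: open_nbhs_nbhs.
Qed.

Lemma weak_space_continuousP (R : realType) (V : normedModType R)
    (X : topologicalType) (f : X -> V) :
  continuous (f : X -> weak_space V) <->
  forall g : continuous_dual V, continuous (sval g \o f : X -> R^o).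
Proof. exact: sup_initial_continuous. Qed.

Lemma prod_topology_continuousP (J : Type) (Z : J -> topologicalType)
    (X : topologicalType) (f : X -> forall j, Z j) :
  continuous (f : X -> prod_topology Z) <-> forall j, continuous (f ^~ j).
Proof. exact: sup_initial_continuous. Qed.

Lemma set_val_continuous (X : topologicalType) (A : set X) :
  continuous (set_val : set_type A -> X).
Proof. exact: initial_continuous. Qed.

Lemma set_type_continuous (X Y : topologicalType) (A : set Y)
    (f : X -> set_type A) :
  continuous (set_val \o f) -> continuous f.
Proof.
move=> cf x U [_ [[W oW <-] Wfx] sub]; apply: filterS sub _; apply: (cf x).
exact: open_nbhs_nbhs.
Qed.

Lemma compact_set_type (X : topologicalType) (A : set X) :
  compact A -> compact [set: set_type A].
Proof.
move=> cA F FF _.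
have [|x [Ax Fx]] := cA (set_val @ F) _.
  suff : F (set_val @^-1` A) by [].
  by apply: filterS filterT => a _; exact: set_valP.
exists (exist _ x (mem_set Ax)); split => // U W FU [_ [[W' oW' <-] W'x] sub].
have [|y [[a Ua <-] W'a]] :=
    Fx (set_val @` U) W' _ (open_nbhs_nbhs (conj oW' W'x)).
  suff : F (set_val @^-1` (set_val @` U)) by [].
  by apply: filterS FU => a; exists a.
by exists a; split => //; exact: sub.
Qed.

Lemma continuous_cluster (X Y : topologicalType) (f : X -> Y) (p q : X) :
  continuous f -> hausdorff_space Y -> cluster (nbhs p) q -> f p = f q.
Proof.
move=> cf hY pq; apply: hY => A B /cf fpA /cf fqB.
by have [x [? ?]] := pq _ _ fpA fqB; exists (f x).
Qed.

Lemma injective_hausdorff (X Y : topologicalType) (f : X -> Y) :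
  continuous f -> injective f -> hausdorff_space Y -> hausdorff_space X.
Proof. by move=> cf fi hY p q /(continuous_cluster cf hY)/fi. Qed.

Lemma compact_hausdorff_homeomorphic (X Y : topologicalType) (f : X -> Y) :
  compact [set: X] -> hausdorff_space Y -> continuous f -> bijective f ->
  homeomorphic X Y.
Proof.
move=> cX hY cf [g fK gK]; exists f, g; split=> //.
apply/continuous_closedP => A cA.
have -> : g @^-1` A = f @` A.
  by apply/seteqP; split=> [y Agy|_ [x Ax <-]]; [exists (g y)|rewrite /= fK].
apply: compact_closed => //; apply: continuous_compact.
  exact: continuous_subspaceT.
exact: subclosed_compact cA cX _.
Qed.

Lemma compact_zero_dim_space (X : topologicalType) :
  compact [set: X] -> hausdorff_space X -> zero_dimensional X ->
  zero_dim_space X.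
Proof.
move=> cX hX zX; exists (@clopen X) => //; split=> [U [] //|x U xU].
have [W [Wx cW] WU] := zero_dimensional_cvg hX zX cX xU.
by exists W.
Qed.


(** * Paths as points of a cube, and their map into the bounded functions *)

Section PathCompact.
Local Open Scope ring_scope.
Variables (R : realType) (I : pointedType).
Local Notation node := (nat * I)%type.
Local Notation cube := (prod_topology (fun _ : node => bool)).
Local Notation unit_ := (@linf_unit R node).
Implicit Types x y : cube.

(** A path may have no node on some level, since limits of branches in the cube can lose nodes. *)
Definition paths : set cube :=
  [set x | forall n i j, x (n, i) -> x (n, j) -> i = j].

(* For N = 0 this embeds the paths into linf; dividing by the level makes the
   tails uniformly small. *)
Definition path_tail N x : linf R node :=
  linf_of (R := R) (fun t => if (N <= t.1)%N && x t then t.1.+1%:R^-1 else 0).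

Definition path_level n x : linf R node :=
  linf_of (R := R) (fun t => ((t.1 == n) && x t)%:R).

Lemma path_tail_bound N x t :
  `|if (N <= t.1)%N && x t then t.1.+1%:R^-1 else 0 : R| <= N.+1%:R^-1.
Proof.
case: ifP => [/andP[Nt _]|_]; last by rewrite normr0 invr_ge0.
by rewrite ger0_norm ?invr_ge0// lef_pV2 ?posrE ?ltr0n// ler_nat.
Qed.

Lemma path_tailE N x t : linf_ev t (path_tail N x) =
  if (N <= t.1)%N && x t then t.1.+1%:R^-1 else 0.
Proof.
apply: linf_ofE => s; apply: le_trans (path_tail_bound N x s) _.
by rewrite invf_le1// ler1n.
Qed.

Lemma path_tail_le N x : `|path_tail N x| <= N.+1%:R^-1.
Proof.
apply: linf_of_le; last exact: path_tail_bound.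
by rewrite invf_le1 ?ltr0n// ler1n.
Qed.

Lemma path_levelE n x t :
  linf_ev t (path_level n x) = ((t.1 == n) && x t)%:R.
Proof. by apply: linf_ofE => s; case: (_ && _); rewrite ?normr1 ?normr0. Qed.

Lemma path_tailS n x :
  path_tail n x = n.+1%:R^-1 *: path_level n x + path_tail n.+1 x.
Proof.
apply: linf_ext => t; rewrite linearP /= !path_tailE path_levelE.
have [->|tn] := eqVneq t.1 n.
  by rewrite leqnn ltnn /= addr0; case: (x t); rewrite [RHS]/= ?scaler0//
    [RHS]mulr1.
by rewrite scaler0 add0r [in RHS]ltn_neqAle eq_sym tn.
Qed.

Lemma path_level_unit n x : paths x ->
  (exists2 i, x (n, i) & path_level n x = unit_ (n, i)) \/
  path_level n x = 0.
Proof.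
move=> px; have [[i xi]|nx] := pselect (exists i, x (n, i)); [left|right].
  exists i => //; apply: linf_ext => -[m j].
  rewrite path_levelE /linf_ev linf_unitE xpair_eqE /=.
  have [->|//] := eqVneq m n.
  suff -> : x (n, j) = (j == i) by [].
  by apply/idP/eqP => [/(px _ _ _ xi)->|->].
apply: linf_ext => -[m j]; rewrite path_levelE linear0 /=.
have [->/=|//] := eqVneq m n.
by case xj : (x (n, j)) => //; exfalso; apply: nx; exists j.
Qed.

Section Functional.
Variable g : {linear linf R node -> R^o}.
Variable e : R.
Hypothesis e_gt0 : 0 < e.

(** A level contributes a single unit or 0. If its node is heavy, with [g] at least [e] in absolute
    value, both paths contain it and the levels coincide; otherwise both values of [g] are at most
    [e] in absolute value. *)
Lemma path_level_close n x y : paths x -> paths y ->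
  (forall t, e <= `|g (unit_ t)| -> x t = y t) ->
  `|g (path_level n x) - g (path_level n y)| <= e + e.
Proof.
move=> px py xy.
have main z w : paths z -> paths w ->
    (forall t, e <= `|g (unit_ t)| -> z t = w t) ->
    `|g (path_level n z)| <= e \/ path_level n z = path_level n w.
  move=> pz pw zw; have [[i zi ->]|->] := path_level_unit n pz; last first.
    by left; rewrite linear0 normr0 ltW.
  have [ei|/ltW] := leP e `|g (unit_ (n, i))|; last by left.
  right; have wi : w (n, i) by rewrite -zw.
  have [[j wj ->]|w0] := path_level_unit n pw; first by rewrite (pw _ _ _ wi wj).
  have := path_levelE n w (n, i).
  by rewrite w0 linear0 /= eqxx wi => /eqP; rewrite eq_sym oner_eq0.
have [xe|->] := main x y px py xy; last by rewrite subrr normr0 addr_ge0 ?ltW.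
have [ye|->] := main y x py px (fun t h => esym (xy t h)).
  by rewrite (le_trans (ler_normB _ _))// lerD.
by rewrite subrr normr0 addr_ge0 ?ltW.
Qed.

(** The first [N] levels are split off one at a time; each costs at most [e + e], as the weights are
    at most 1. *)
Lemma path_tail_close N x y : paths x -> paths y ->
  (forall t, e <= `|g (unit_ t)| -> x t = y t) ->
  `|g (path_tail 0 x) - g (path_tail 0 y)| <=
    (e + e) *+ N + `|g (path_tail N x) - g (path_tail N y)|.
Proof.
move=> px py xy; elim: N => [|N IHN]; first by rewrite mulr0n add0r.
apply: (le_trans IHN); rewrite mulrSr -addrA lerD2l.
rewrite !(path_tailS N) !(linearP g) opprD addrACA -scalerBr.
rewrite (le_trans (ler_normD _ _))// lerD2r normrZ.
apply: le_trans (path_level_close N px py xy).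
by rewrite ger0_norm ?invr_ge0// ler_piMl// invf_le1// ler1n.
Qed.

End Functional.

(** For a given functional only finitely many nodes are heavy. Agreement at these nodes is an open
    condition in the cube, and it bounds the variation of the functional. *)
Lemma path_tail_weakly_continuous (P : set cube) (PL : P `<=` paths) :
  continuous ((path_tail 0 \o set_val) : set_type P -> weak_space (linf R node)).
Proof.
apply/weak_space_continuousP => -[g cg] x.
move=> A /nbhs_ballP[e /= e0 eA].
suff : \forall y \near x,
    `|g (path_tail 0 (set_val x)) - g (path_tail 0 (set_val y))| < e.
  by apply: filterS => y xy; apply: eA; rewrite -ball_normE.
have [M M0 gM] := linear_bounded_pos cg.
(* With this [N], [g] is at most [e / 4] in absolute value on every tail from level [N]; with this
   [d], the first [N] levels cost [(d + d) *+ N], which is less than [e / 2]. *)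
pose N := Num.truncn (4 * M / e).
pose d := e / (4 * N.+1%:R).
have d0 : 0 < d by rewrite divr_gt0// mulr_gt0// ltr0n.
have Dfin := linf_units_weakly_null cg d0.
pose D := [set t | d <= `|g (unit_ t)|].
suff : \forall y \near x, forall t, D t -> set_val x t = set_val y t.
  apply: filterS => y xy.
  have px : paths (set_val x) by apply: PL; exact: set_valP.
  have py : paths (set_val y) by apply: PL; exact: set_valP.
  apply: le_lt_trans (path_tail_close d0 N px py xy) _.
  rewrite [ltRHS](splitr e) ltr_leD//.
    have : d * (4 * (N%:R + 1)) = e.
      by rewrite natr1 /d mulfVK// mulf_neq0// pnatr_eq0.
    by rewrite -(mulr_natr (d + d) N) => dN; lra.
  have tl z : `|g (path_tail N z)| <= e / 4.
    apply: le_trans (gM _) _.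
    apply: le_trans (ler_wpM2l (ltW M0) (path_tail_le N z)) _.
    rewrite ler_pdivrMr ?ltr0n//.
    have : 4 * M / e < N.+1%:R by exact: truncnS_gt.
    by rewrite ltr_pdivrMr// => MN; lra.
  apply: le_trans (ler_normB _ _) _.
  apply: le_trans (lerD (tl _) (tl _)) _.
  by rewrite (_ : e / 4 + e / 4 = e / 2)//; field.
have [F DF] := finite_fsetP.1 Dfin.
suff : \forall y \near x, (\bigcap_(t in [set` F])
    [set y : set_type P | set_val y t = set_val x t]) y.
  by apply: filterS => y xy t Dt; apply/esym/xy; rewrite -DF.
apply: filter_bigI => t _.
have /prod_topology_continuousP/(_ t) := @set_val_continuous _ P.
by move=> /(_ x [set set_val x t]); apply; exact: discrete_set1.
Qed.

End PathCompact.

Arguments paths {I}.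

(** * The compact closure of the branches in the cube *)

Section PathClosure.
Variables (R : realType) (I : pointedType) (P : set (nat -> I)).
Local Notation node := (nat * I)%type.
Local Notation cube := (prod_topology (fun _ : node => bool)).
Local Notation Y := (sequence_space R P).

Lemma cube_coord_clopen (t : node) : clopen [set x : cube | x t].
Proof.
have /(_ (nat * I)%type (fun=> bool) cube id) h := @prod_topology_continuousP.
have ct : continuous (fun x : cube => x t).
  by apply: (iffLR h) => x; exact: cvg_id.
have /preimage_clopen : clopen [set b : bool | b].
  by split; [exact: discrete_open|exact: discrete_closed].
by apply.
Qed.

Lemma cube_compact : compact [set: cube].
Proof.
have := @tychonoff node _ _ (fun=> bool_compact).
by congr (compact _); rewrite eqEsubset.
Qed.

Lemma cube_hausdorff : hausdorff_space cube.
Proof. by apply: hausdorff_product => ?; exact: discrete_hausdorff. Qed.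

Lemma paths_closed : closed (paths : set cube).
Proof.
move=> x px n i j xi xj.
have [y [py [yi yj]]] : (paths `&` ([set y : cube | y (n, i)] `&`
    [set y : cube | y (n, j)])) !=set0.
  apply: px; apply: open_nbhs_nbhs; split => //.
  by apply: openI; exact: (cube_coord_clopen _).1.
exact: py yi yj.
Qed.

Definition path_of (b : Y) : cube := fun t => `[< sval b t.1 = t.2 >].

Definition path_closure : set cube := closure (range path_of).

Lemma path_closure_paths : path_closure `<=` paths.
Proof.
apply: (@subset_trans _ (closure paths)); last first.
  by rewrite -(iffLR (closure_id _) paths_closed).
apply: closureS => _ [b _ <-] n i j /asboolP /= <- /asboolP /= <-.
by [].
Qed.

Lemma path_of_closure b : path_of b \in path_closure.
Proof. by apply/mem_set/subset_closure; exists b. Qed.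

Definition path_embed b : set_type path_closure :=
  exist _ (path_of b) (path_of_closure b).

Lemma path_prefix_open n (b : Y) :
  open [set x : cube | forall i, (i < n)%N -> x (i, sval b i)].
Proof.
elim: n => [|n IHn].
  by rewrite (_ : [set _ | _] = setT)//; [exact: openT|apply/seteqP; split].
rewrite (_ : [set _ | _] = [set x : cube | forall i, (i < n)%N -> x (i, sval b i)]
    `&` [set x : cube | x (n, sval b n)]).
  by apply: openI => //; exact: (cube_coord_clopen _).1.
apply/seteqP; split=> [x h|x [h xn] i].
  by split=> [i /ltnW|]; exact: h.
by rewrite ltnS leq_eqVlt => /predU1P[->//|]; exact: h.
Qed.

Lemma path_embed_dense : dense_embedding path_embed.
Proof.
split.
- apply: set_type_continuous; apply/prod_topology_continuousP => t b A At.
  apply: filterS (nbhs_cylinder t.1 b) => c bc.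
  have bct : path_of b t = path_of c t by rewrite /path_of bc.
  by have := nbhs_singleton At; rewrite /= set_valE /= bct.
- move=> U [x Ux] [W oW WU].
  have := set_valP x => /(_ W); case.
    by apply: open_nbhs_nbhs; split => //; rewrite -WU in Ux.
  move=> _ [[b _ <-] Wb]; exists (path_embed b); split; last by exists b.
  by rewrite -WU.
- move=> U oU.
  (* A cylinder is cut out by requiring the nodes of a finite prefix to be present; the bound is
     [t.1.+1] because level [t.1] is included. *)
  pose W : set cube := \bigcup_(t in [set t : nat * Y | cylinder t.1 t.2 `<=` U])
    [set x : cube | forall i, (i < t.1.+1)%N -> x (i, sval t.2 i)].
  exists (set_val @^-1` W).
    by exists W => //; apply: bigcup_open => t _; exact: path_prefix_open.
  apply/seteqP; split=> [b Ub|b [t tU tb]].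
    have [n nU] := nbhs_cylinderP (open_nbhs_nbhs (conj oU Ub)).
    by exists (n, b) => // i _; apply/asboolP.
  by apply: tU => i it; have /asboolP/esym := tb i it.
Qed.

(** The map [path_tail R 0] is injective, since its value at a node is nonzero exactly when the path
    contains that node; compactness makes it a homeomorphism onto its range. The coordinate sets
    give clopen sets separating points. *)
Lemma path_closure_eberlein0 : eberlein_compact0 R (set_type path_closure).
Proof.
have cC : compact path_closure.
  apply: (subclosed_compact _ cube_compact) => //; exact: closed_closure.
have cS := compact_set_type cC.
have hS : hausdorff_space (set_type path_closure).
  exact: (injective_hausdorff (@set_val_continuous _ _) val_inj cube_hausdorff).
pose h := path_tail R 0 \o (set_val : set_type path_closure -> cube).
have ch : continuous (h : _ -> weak_space (linf R node)).
  exact/path_tail_weakly_continuous/path_closure_paths.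
have hi : injective h.
  move=> x y hxy; apply/val_inj/funext => t.
  have n0 : (t.1.+1%:R^-1 : R)%R <> 0%R by apply/eqP; rewrite invr_eq0 pnatr_eq0.
  have : set_val x t = set_val y t; last by [].
  have := path_tailE R 0 (set_val x) t; rewrite -[path_tail _ _ _]/(h x) hxy.
  rewrite path_tailE /=.
  by case: (set_val x t); case: (set_val y t) => // h0; case: n0;
    first [exact: h0|exact: (esym h0)].
split; last first.
  apply: compact_zero_dim_space => // x y /eqP xy.
  have [t xyt] : exists t, set_val x t <> set_val y t.
    apply: contrapT => nt; apply/xy/val_inj/funext => t.
    by apply: contrapT => h'; apply: nt; exists t.
  pose U := (set_val : set_type path_closure -> cube) @^-1` [set z : cube | z t].
  have cU : clopen U := preimage_clopen (cube_coord_clopen t)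
    (@set_val_continuous _ path_closure).
  have [xt|xt] := boolP (set_val x t).
    by exists U; split => // yt; apply: xyt; rewrite xt; exact/esym.
  exists (~` U); split; [exact: clopenC|exact/negP|].
  move=> nUy; apply: xyt; rewrite (negbTE xt); apply/esym/negbTE/negP => yt.
  exact: nUy.
split => //; exists (linf R node), (range h); split.
  apply: continuous_compact cS.
  exact: continuous_subspaceT.
have hr x : h x \in range h by apply/mem_set; exists x.
pose K : set (weak_space (linf R node)) := range h.
apply: (@compact_hausdorff_homeomorphic _ _
  (fun x => exist _ (h x) (hr x) : set_type K)) => //.
- move=> p q pq; apply/val_inj/linf_ext => t.
  (* Evaluations at nodes are weakly continuous and separate functions, so the range is
     Hausdorff. *)
  pose ev : continuous_dual (linf R node) := @exist _
    (fun f : {linear linf R node -> R^o} => continuous (f : linf R node -> R^o))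
    (linf_ev t : {linear linf R node -> R^o}) (@linf_ev_continuous R node t).
  have := @set_val_continuous _ (range h : set (weak_space _)).
  move=> /weak_space_continuousP/(_ ev) cev.
  exact: (continuous_cluster cev (@Rhausdorff R) pq).
- exact: set_type_continuous.
- have /choice[k hk] (v : set_type (range h)) : exists x, h x = val v.
    by have [x _ xv] := set_valP v; exists x.
  exists k => [x|v]; first by apply: hi; rewrite hk.
  by apply: val_inj; rewrite /= hk.
Qed.

End PathClosure.

(** * The Hahn-Banach theorem *)

Section HahnBanach.
Local Open Scope ring_scope.
Variables (R : realType) (V : lmodType R).
Implicit Types (p q : V -> R) (x y : V).

Definition sublinear q :=
  (forall x y, q (x + y) <= q x + q y) /\
  (forall a x, 0 < a -> q (a *: x) = a * q x).

Lemma sublinear0 q : sublinear q -> q 0 = 0.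
Proof. by move=> [_ /(_ 2 0 (ltr0Sn _ _))]; rewrite scaler0; lra. Qed.

Lemma sublinearN q x : sublinear q -> - q (- x) <= q x.
Proof. by move=> sq; have := sq.1 x (- x); rewrite subrr sublinear0//; lra. Qed.

Lemma sublinearZ q a x : sublinear q -> 0 <= a -> q (a *: x) = a * q x.
Proof.
move=> sq; rewrite le_eqVlt => /predU1P[<-|/sq.2//].
by rewrite scale0r mul0r sublinear0.
Qed.

Section InfSublinear.
Variables (J : Type) (D : set J) (F : J -> V -> R).
Hypothesis D0 : D !=set0.
Hypothesis F_lb : forall x, exists m, forall j, D j -> m <= F j x.

Definition inf_fun x : R := inf [set F j x | j in D].

Lemma inf_fun_le j x : D j -> inf_fun x <= F j x.
Proof.
move=> Dj; apply: ge_inf; last by exists j.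
by have [m Fm] := F_lb x; exists m => _ [i Di <-]; exact: Fm.
Qed.

Lemma le_inf_fun m x : (forall j, D j -> m <= F j x) -> m <= inf_fun x.
Proof.
move=> mF; apply: lb_le_inf; last by move=> _ [j Dj <-]; exact: mF.
by have [j Dj] := D0; exists (F j x), j.
Qed.

(** This serves for three infima: the shifts of a functional, the lower bound of a chain in Zorn's
    lemma, and the distance to a subspace. *)
Lemma inf_fun_sublinear :
  (forall i j x y, D i -> D j -> exists2 k, D k & F k (x + y) <= F i x + F j y) ->
  (forall j a x, D j -> 0 < a -> exists2 k, D k & F k (a *: x) <= a * F j x) ->
  sublinear inf_fun.
Proof.
move=> hD hZ; split=> [x y|].
  rewrite -lerBlDr; apply: le_inf_fun => i Di.
  rewrite lerBlDr -lerBlDl; apply: le_inf_fun => j Dj.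
  rewrite lerBlDl; have [k Dk Fk] := hD i j x y Di Dj.
  exact: le_trans (inf_fun_le _ Dk) Fk.
have le a x : 0 < a -> inf_fun (a *: x) <= a * inf_fun x.
  move=> a0; rewrite -ler_pdivrMl//; apply: le_inf_fun => j Dj.
  rewrite ler_pdivrMl//; have [k Dk Fk] := hZ j a x Dj a0.
  exact: le_trans (inf_fun_le _ Dk) Fk.
move=> a x a0; apply/le_anti; rewrite le//= -ler_pdivlMl//.
rewrite -[X in inf_fun X](scalerK (lt0r_neq0 a0)).
by rewrite le// invr_gt0.
Qed.

End InfSublinear.

(* A minimal sublinear functional equals all its shifts, and these are linear
   in the direction y; so it is linear. *)
Definition sublinear_shift q y x : R :=
  inf_fun [set t : R | 0 <= t] (fun t x => q (x + t *: y) - t * q y) x.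

Section Shift.
Variables (q : V -> R) (y : V).
Hypothesis sq : sublinear q.

Let shift_set0 : [set t : R | 0 <= t] !=set0. Proof. by exists 0 => /=. Qed.

Let shift_lb x : exists m, forall t, [set t : R | 0 <= t] t ->
  m <= q (x + t *: y) - t * q y.
Proof.
exists (- q (- x)) => t /= t0; rewrite -(sublinearZ _ sq)//.
have := sq.1 (x + t *: y) (- x); rewrite addrAC subrr add0r; lra.
Qed.

Lemma sublinear_shift_le t x : 0 <= t ->
  sublinear_shift q y x <= q (x + t *: y) - t * q y.
Proof. by move=> t0; exact: (inf_fun_le shift_lb). Qed.

Lemma sublinear_shift_le0 x : sublinear_shift q y x <= q x.
Proof.
apply: le_trans (@sublinear_shift_le 0 x _) _ => //.
by rewrite scale0r addr0 mul0r subr0.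
Qed.

Lemma sublinear_shiftN : sublinear_shift q y (- y) <= - q y.
Proof.
apply: le_trans (@sublinear_shift_le 1 (- y) _) _ => //.
by rewrite scale1r addNr mul1r sublinear0// sub0r.
Qed.

Lemma sublinear_shift_sublinear : sublinear (sublinear_shift q y).
Proof.
apply: (inf_fun_sublinear shift_set0 shift_lb).
- move=> s t x z /= s0 t0; exists (s + t); first exact: addr_ge0.
  by have := sq.1 (x + s *: y) (z + t *: y); rewrite addrACA -scalerDl; lra.
- move=> t a x /= t0 a0; exists (a * t); first by rewrite mulr_ge0// ltW.
  by rewrite -scalerA -scalerDr sq.2// mulrBr mulrA.
Qed.

End Shift.

(** Zorn's lemma for the reversed pointwise order. A nonempty chain is bounded by its pointwise
    infimum, which is finite because every member is at least [- p (- x)] at [x]. *)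
Lemma minimal_sublinear p : sublinear p -> exists q, [/\ sublinear q,
  (forall x, q x <= p x) &
  forall r, sublinear r -> (forall x, r x <= q x) -> r = q].
Proof.
move=> sp.
pose T := {q | sublinear q /\ forall x, q x <= p x}.
pose le (q r : T) := `[< forall x, sval r x <= sval q x >].
have [||||[q [sq qp]] qmin] := @Zorn T le.
- by move=> q; apply/asboolP.
- move=> q r s /asboolP qr /asboolP rs; apply/asboolP => x.
  exact: le_trans (rs x) (qr x).
- move=> [q hq] [r hr] /asboolP/= qr /asboolP/= rq; apply: eq_exist.
  by apply/funext => x; apply/le_anti; rewrite qr rq.
- move=> A totA; have [A0|] := pselect (A !=set0); last first.
    move=> A0; exists (exist _ p (conj sp (fun x => lexx (p x)))) => s As.
    by exfalso; apply: A0; exists s.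
  have lb x : exists m, forall q : T, A q -> m <= sval q x.
    exists (- p (- x)) => -[q [sq qp]] _ /=.
    by apply: le_trans (sublinearN x sq); rewrite lerN2.
  have si : sublinear (inf_fun A (fun q : T => sval q)).
    apply: (inf_fun_sublinear A0 lb).
    - move=> q r x y Aq Ar.
      have [/asboolP qr|/asboolP rq] := totA _ _ Aq Ar.
        exists r => //; apply: le_trans ((svalP r).1.1 x y) _.
        by rewrite lerD2r.
      exists q => //; apply: le_trans ((svalP q).1.1 x y) _.
      by rewrite lerD2l.
    - move=> q a x Aq a0; exists q => //.
      by rewrite (svalP q).1.2.
  have ip x : inf_fun A (fun q : T => sval q) x <= p x.
    have [q Aq] := A0; apply: le_trans (inf_fun_le lb x Aq) _.
    exact: (svalP q).2.
  exists (exist (fun q => sublinear q /\ forall x, q x <= p x) _ (conj si ip)).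
  move=> q Aq; apply/asboolP => x /=.
  exact: (inf_fun_le lb).
exists q; split => // r sr rq.
have rp x : r x <= p x by exact: le_trans (rq x) (qp x).
have /qmin/(congr1 sval) : le (exist _ q (conj sq qp)) (exist _ r (conj sr rp)).
  exact/asboolP.
by [].
Qed.

(** The minimal functional is taken below the shift of [p] along [v], not merely below [p]: this
    forces [g (- v) <= - p v], hence [g v = p v]. *)
Theorem hahn_banach_sublinear p v : sublinear p ->
  exists g : {linear V -> R^o}, (forall x, g x <= p x) /\ g v = p v.
Proof.
move=> sp.
have [g [sg gp gmin]] := minimal_sublinear (sublinear_shift_sublinear v sp).
have gN y : g (- y) = - g y.
  have gy := gmin _ (sublinear_shift_sublinear y sg) (sublinear_shift_le0 y sg).
  apply/le_anti/andP; split; last first.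
    by have := sublinearN (- y) sg; rewrite opprK; lra.
  by rewrite -[X in X (- y)]gy; exact: sublinear_shiftN.
have glin : linear (g : V -> R^o).
  have gD x y : g (x + y) = g x + g y.
    apply/le_anti; rewrite sg.1 /=.
    by have := sg.1 (- x) (- y); rewrite -opprD !gN; lra.
  move=> a x y; rewrite gD; congr (_ + _).
  have [a0|a0] := leP 0 a; first exact: sublinearZ.
  rewrite -[X in X *: x]opprK scaleNr gN sublinearZ// ?oppr_ge0 ?ltW//.
  by rewrite mulNr opprK.
pose G : {linear V -> R^o} :=
  HB.pack (g : V -> R^o) (GRing.isLinear.Build _ _ _ _ _ glin).
have gle x : g x <= p x by exact: le_trans (gp x) (sublinear_shift_le0 v sp x).
exists G; split => //; apply/le_anti; rewrite gle /=.
by have := gp (- v); have := sublinear_shiftN v sp; rewrite gN; lra.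
Qed.

End HahnBanach.

(** * Norm fragmentation of weakly compact sets *)

Section Functionals.
Local Open Scope ring_scope.
Variables (R : realType) (V : normedModType R).

Lemma linear_le_norm_continuous (g : {linear V -> R^o}) :
  (forall x, g x <= `|x|) -> continuous g.
Proof.
move=> gle; apply/linear_bounded_continuous/linear_boundedP.
near=> r => x; rewrite (@le_trans _ _ `|x|)//.
  by rewrite ler_norml gle -lerNl -linearN -normrN gle.
by rewrite ler_peMl.
Unshelve. all: by end_near. Qed.

Lemma norm_sublinear : sublinear (fun x : V => `|x|).
Proof.
split=> [x y|a x a0]; first exact: ler_normD.
by rewrite normrZ gtr0_norm.
Qed.

Lemma norming_functional (v : V) : exists g : {linear V -> R^o},
  [/\ continuous g, forall x, g x <= `|x| & g v = `|v|].
Proof.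
have [g [gle gv]] := hahn_banach_sublinear v norm_sublinear.
by exists g; split => //; exact: linear_le_norm_continuous.
Qed.

(** Hahn-Banach is applied to the distance to the subspace [D]. This distance vanishes on [D], so
    [g] is at most 0 at [w] and at [- w]. *)
Lemma separating_functional (D : set V) (v : V) (e : R) :
  D 0 -> (forall x y, D x -> D y -> D (x + y)) ->
  (forall a x, D x -> D (a *: x)) ->
  (forall w, D w -> e <= `|v - w|) ->
  exists g : {linear V -> R^o},
    [/\ continuous g, forall w, D w -> g w = 0 & e <= g v].
Proof.
move=> D0 DD DZ Dv; have Dn0 : D !=set0 by exists 0.
have lb x : exists m, forall w, D w -> m <= `|x - w|.
  by exists 0 => w _.
have sp : sublinear (inf_fun D (fun w x => `|x - w|)).
  apply: (inf_fun_sublinear Dn0 lb).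
  - move=> w z x y Dw Dz; exists (w + z); first exact: DD.
    by rewrite opprD addrACA ler_normD.
  - move=> w a x Dw a0; exists (a *: w); first exact: DZ.
    by rewrite -scalerBr normrZ gtr0_norm.
have [g [gle gv]] := hahn_banach_sublinear v sp.
exists g; split.
- apply: linear_le_norm_continuous => x; apply: le_trans (gle x) _.
  by apply: le_trans (inf_fun_le lb x D0) _; rewrite subr0.
- have le0 w : D w -> g w <= 0.
    move=> Dw; apply: le_trans (gle w) _.
    by apply: le_trans (inf_fun_le lb w Dw) _; rewrite subrr normr0.
  move=> w Dw; apply/le_anti; rewrite le0//= -oppr_le0 -linearN le0//.
  by rewrite -scaleN1r; exact: DZ.
- by rewrite gv; apply: (le_inf_fun Dn0).
Qed.

(** The map [f] is [id] for real coefficients and [ratr] for rational ones. *)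
Definition combination (K : Type) (f : K -> R) (u : nat -> V)
    (s : seq (K * nat)) : V :=
  \sum_(t <- s) f t.1 *: u t.2.

Lemma rational_combination_dense (u : nat -> V) (s : seq (R * nat)) (e : R) :
  0 < e -> exists r : seq (rat * nat),
    `|combination id u s - combination ratr u r| < e.
Proof.
elim: s e => [e e0|[a i] s IHs e e0].
  by exists [::]; rewrite /combination !big_nil subrr normr0.
have [r sr] := IHs (e / 2) (divr_gt0 e0 (ltr0Sn R 1)).
(* An error [d] in the coefficient of [u i] costs at most [e / 2]; adding 1 avoids a zero
   denominator when [u i] is 0. *)
pose d := e / 2 / (`|u i| + 1).
have u1 : 0 < `|u i| + 1 by rewrite ltr_wpDl.
have d0 : 0 < d by rewrite !divr_gt0.
have [q] : exists q, ratr q \in `]a, a + d[ by apply: rat_in_itvoo; rewrite ltrDl.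
rewrite in_itv /= => /andP[aq qa].
exists ((q, i) :: r); rewrite /combination !big_cons /= opprD addrACA -scalerBl.
apply: le_lt_trans (ler_normD _ _) _; rewrite [ltRHS]splitr.
apply: ler_ltD sr; rewrite normrZ.
have aqd : `|a - ratr q| <= d by rewrite distrC ltW// gtr0_norm; lra.
apply: le_trans (ler_wpM2r (normr_ge0 _) aqd) _.
have : d * (`|u i| + 1) = e / 2 by rewrite /d mulfVK ?lt0r_neq0.
by lra.
Qed.

End Functionals.

Lemma injective_unbounded (f : nat -> nat) N :
  injective f -> exists k, (N <= f k)%N.
Proof.
move=> fi; apply: contrapT => nf.
have : (size (map f (iota 0 N.+1)) <= size (iota 0 N))%N.
  apply: uniq_leq_size; first by rewrite map_inj_uniq// iota_uniq.
  move=> _ /mapP[k _ ->]; rewrite mem_iota /= add0n ltnNge.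
  by apply/negP => Nf; apply: nf; exists k.
by rewrite size_map !size_iota ltnn.
Qed.

Lemma compact_shrink (X : topologicalType) (U : set X) :
  compact [set: X] -> hausdorff_space X -> open U -> U !=set0 ->
  exists W, [/\ open W, W !=set0 & closure W `<=` U].
Proof.
move=> cX hX oU [x Ux].
have xU : nbhs x U by exact: open_nbhs_nbhs.
have [B Bx BU] := compact_regular hX cX filterT xU.
exists (interior B); split; [exact: open_interior| |].
  by exists x.
by apply: subset_trans BU; apply: closureS; exact: interior_subset.
Qed.

(** The point is a cluster point of [xs]. The second clause is meant for the zero set of a
    functional vanishing on all [xs n]. *)
Lemma compact_nested (X : topologicalType) (W : nat -> set X) (xs : nat -> X) :
  compact [set: X] -> (forall n, closure (W n.+1) `<=` W n) ->
  (forall n, W n (xs n)) ->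
  exists x, (forall n, W n x) /\
    forall C, closed C -> (forall n, C (xs n)) -> C x.
Proof.
move=> cX WS Wxs; have [x [_ xcl]] := cX (xs @ \oo) _ filterT.
have Wm n m : (n <= m)%N -> W m `<=` W n.
  elim: m => [|m IHm]; first by rewrite leqn0 => /eqP->.
  rewrite leq_eqVlt => /predU1P[->//|/IHm]; apply: subset_trans.
  by apply: subset_trans (WS m); exact: subset_closure.
exists x; split=> [n|C cC Cxs].
  apply: WS => B Bx; have : (xs @ \oo) (W n.+1).
    by exists n.+1 => // m /= nm; exact: Wm nm _ (Wxs m).
  by move=> /xcl; apply.
apply: cC => B Bx; have : (xs @ \oo) C by exists 0%N => // m _; exact: Cxs.
by move=> /xcl; apply.
Qed.

Section Fragmentation.
Local Open Scope ring_scope.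
Variables (R : realType) (V : normedModType R) (X : topologicalType).
Variable phi : X -> V.
Hypothesis cX : compact [set: X].
Hypothesis hX : hausdorff_space X.
Hypothesis wphi : forall g : {linear V -> R^o}, continuous g ->
  continuous (g \o phi : X -> R^o).

Definition norm_small (e : R) (U : set X) :=
  forall x y, U x -> U y -> `|phi x - phi y| <= e.

(** This is weak lower semicontinuity of the norm: a functional norming [phi x - q] keeps nearby
    values far from [q]. *)
Lemma far_open (q : V) (e : R) : open [set x | e < `|phi x - q|].
Proof.
rewrite openE => x /= ex; have [g [cg gle gx]] := norming_functional (phi x - q).
have gxe : e + g q < (g \o phi) x by rewrite -ltrBrDr /= -linearB gx.
have /continuousP/(_ _ (@open_gt R (e + g q))) og := wphi cg.
apply: filterS (open_nbhs_nbhs (conj og gxe)) => y /=.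
by rewrite -ltrBrDr -linearB => /lt_le_trans; apply.
Qed.

Theorem weakly_compact_fragmented (O : set X) (e : R) : 0 < e ->
  open O -> O !=set0 ->
  exists U, [/\ open U, U !=set0, U `<=` O & norm_small e U].
Proof.
move=> e0 oO O0; have [x0 Ox0] := O0.
apply: contrapT => nO.
(* A nonempty open subset of [O] staying within [e / 2] of one vector would have norm diameter at
   most [e]; so [W] can always be shrunk away from the ball around [q]. *)
have step (Wq : set X * V) : exists W', open Wq.1 -> Wq.1 !=set0 -> Wq.1 `<=` O ->
    [/\ open W', W' !=set0 &
        closure W' `<=` Wq.1 `&` [set x | e / 2 < `|phi x - Wq.2|]].
  case: Wq => W q /=.
  have [oW|] := pselect (open W); last by exists set0.
  have [W0|] := pselect (W !=set0); last by exists set0.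
  have [WO|] := pselect (W `<=` O); last by exists set0.
  have [|W' [oW' W'0 cW']] := @compact_shrink X
    (W `&` [set x | e / 2 < `|phi x - q|]) cX hX (openI oW (far_open q (e / 2))).
    apply: contrapT => Wq0; apply: nO; exists W; split => // x y Wx Wy.
    have near z : W z -> `|phi z - q| <= e / 2.
      by move=> Wz; rewrite leNgt; apply/negP => zq; apply: Wq0; exists z.
    rewrite -(subrKA q) (le_trans (ler_normD _ _))// [leRHS]splitr lerD//.
      exact: near.
    by rewrite distrC near.
  by exists W'.
have [next hnext] := choice step.
pose pt (W : set X) := xget x0 W.
(* A code n with first component k lists the coefficients of a combination of
   the points chosen so far; as k varies, the combination comes back at
   arbitrarily late stages. *)
pose code : countType := (nat * seq (rat * nat))%type.
pose dec (n : nat) : seq (rat * nat) :=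
  if @choice.unpickle code n is Some ks then ks.2 else [::].
(* The state pairs the current open set with the images of the points chosen so far; indices beyond
   the list stand for the vector 0. *)
pose st := fix st n : set X * seq V := if n is m.+1 then
    let l := rcons (st m).2 (phi (pt (st m).1)) in
    (next ((st m).1, combination ratr (nth 0 l) (dec m)), l)
  else (O, [::]).
pose W n := (st n).1.
pose xs n := pt (W n).
pose u n := phi (xs n).
pose q n := combination ratr (nth 0 (mkseq u n.+1)) (dec n).
have st2 n : (st n).2 = mkseq u n.
  by elim: n => [//|n IHn]; rewrite mkseqS /= IHn.
have WS n : W n.+1 = next (W n, q n).
  by rewrite /q mkseqS -st2.
have W_ok n : [/\ open (W n), W n !=set0 & W n `<=` O].
  elim: n => [|n [on n0 nO']]; first by split=> //; rewrite /W /=.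

  have [|||oW' W'0 cW'] := hnext (W n, q n) => //.
  rewrite WS; split => //; apply: subset_trans nO'.
  apply: subset_trans (subset_trans cW' (@subIsetl _ _ _)).
  exact: subset_closure.
have W_next n : closure (W n.+1) `<=` W n `&` [set x | e / 2 < `|phi x - q n|].
  by have [oW W0 WO] := W_ok n; rewrite WS; have [] := hnext (W n, q n) oW W0 WO.
have Wxs n : W n (xs n) by have [_ W0 _] := W_ok n; exact: (xgetPex x0 W0).
have [x [Wx xcl]] := compact_nested cX
  (fun n => subset_trans (W_next n) (@subIsetl _ _ _)) Wxs.
have far n : e / 2 < `|phi x - q n|.
  by have [] := W_next n x (subset_closure (Wx n.+1)).
have far_rat s : e / 2 < `|phi x - combination ratr u s|.
  (* The sum exceeds every index occurring in [s]; at a stage beyond it, the finite list gives the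
     same combination as the whole sequence [u]. *)
  have [k kN] := @injective_unbounded
    (fun k => choice.pickle ((k, s) : code)) (\sum_(t <- s) t.2.+1)
    (fun k l h => congr1 fst (pcan_inj (@choice.pickleK code) h)).
  have := far (choice.pickle ((k, s) : code)); rewrite /q /dec choice.pickleK /=.
  rewrite (_ : combination _ (nth 0 _) s = combination ratr u s)//.
  rewrite /combination !big_seq; apply: eq_bigr => t ts.
  rewrite nth_mkseq// ltnS (leq_trans _ kN)//.
  by rewrite (big_rem t)//= (leq_trans (leqnSn _))// leq_addr.
pose D : set V := range (combination id u).
(* Rational combinations are farther than [e / 2] and approximate real ones within [e / 4], so
   [phi x] is at least [e / 4] away from the whole span. *)
have [g [cg gD gx]] : exists g : {linear V -> R^o},
    [/\ continuous g, forall w, D w -> g w = 0 & e / 4 <= g (phi x)].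
  apply: separating_functional.
  - by exists [::] => //; rewrite /combination big_nil.
  - move=> _ _ [s _ <-] [t _ <-]; exists (s ++ t) => //.
    by rewrite /combination big_cat.
  - move=> a _ [s _ <-]; exists (map (fun t => (a * t.1, t.2)) s) => //.
    rewrite /combination big_map scaler_sumr; apply: eq_bigr => t _.
    by rewrite scalerA.
  - move=> _ [s _ <-].
    have [r sr] := rational_combination_dense u s (divr_gt0 e0 (ltr0Sn R 3)).
    have := far_rat r; rewrite -(subrKA (combination id u s)).
    move=> /lt_le_trans/(_ (ler_normD _ _)); lra.
have gu n : g (u n) = 0.
  by apply: gD; exists [:: (1, n)] => //; rewrite /combination big_seq1 scale1r.
(* The continuous map [g \o phi] vanishes at every [xs n], hence at the cluster point [x], against
   [e / 4 <= g (phi x)]. *)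
have gx0 : (g \o phi) x = 0.
  apply: (xcl ((g \o phi) @^-1` [set 0])) => //.
  have /continuous_closedP := wphi cg; apply.
  exact: closed_eq.
by move: gx; rewrite [g _]gx0 leNgt divr_gt0.
Qed.

End Fragmentation.

(** * Equality of the classes *)

Lemma homeomorphic_regular_opens (X Y : topologicalType) :
  homeomorphic X Y -> boolean_isomorphic (regular_opens X) (regular_opens Y).
Proof.
move=> [f [g [fK gK cf cg]]]; apply: (@dense_embedding_regular_opens _ _ g).
split=> // [U [x Ux] _|U oU].
  by exists x; split => //; exists (f x).
exists (f @^-1` U); first by move/continuousP : cf; exact.
by apply/seteqP; split=> y /=; rewrite gK.
Qed.

Lemma dense_regular_opens (X : topologicalType) (D : set X) : dense D ->
  boolean_isomorphic (regular_opens X) (regular_opens (set_type D)).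
Proof.
move=> dD.
apply: (@dense_embedding_regular_opens _ _ (set_val : set_type D -> X)).
split; first exact: set_val_continuous.
  move=> U U0 oU; have [x [Ux Dx]] := dD U U0 oU.
  by exists x; split => //; exists (exist _ x (mem_set Dx)).
by move=> _ [U oU <-]; exists U.
Qed.

Lemma closure_regular_opens (X : topologicalType) (S : set X) :
  boolean_isomorphic (regular_opens (set_type (closure S)))
    (regular_opens (set_type S)).
Proof.
have cS (s : set_type S) : set_val s \in closure S.
  by apply/mem_set/subset_closure; exact: set_valP.
pose e s : set_type (closure S) := exist _ (set_val s) (cS s).
apply: (@dense_embedding_regular_opens _ _ e); split.
- by apply: set_type_continuous; exact: set_val_continuous.
- move=> B [x Bx] [U oU UB]; rewrite -{}UB in Bx *.
  have [y [Sy Uy]] := set_valP x _ (open_nbhs_nbhs (conj oU Bx)).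
  pose s : set_type S := exist _ y (mem_set Sy).
  by exists (e s); split => //; exists s.
- move=> _ [U oU <-]; exists (set_val @^-1` U) => //.
  by exists U.
Qed.

Section SmallOpens.
Local Open Scope ring_scope.
Variable R : realType.

Lemma natinv_lt (e : R) : 0 < e -> exists n, n.+1%:R^-1 < e.
Proof.
move=> e0; exists (Num.truncn e^-1).
rewrite -[ltRHS]invrK ltf_pV2 ?posrE ?invr_gt0 ?ltr0n//.
exact: truncnS_gt.
Qed.

Lemma metric_sequence_space (M : metricType R) :
  exists P : set (nat -> set M), boolean_isomorphic (regular_opens M)
    (regular_opens (sequence_space R P)).
Proof.
pose S n (U : set M) := forall x y, U x -> U y -> mdist x y <= n.+1%:R^-1.
apply: (@dense_small_opens_sequence_space R M S) => [n U oU [x Ux]|U oU [x Ux]].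
- have n0 : 0 < (n.+1%:R^-1 / 2 : R) by rewrite divr_gt0// invr_gt0.
  pose B := interior (ball x (n.+1%:R^-1 / 2 : R)).
  have Bx : B x by exact: nbhsx_ballx.
  exists (B `&` U); split.
  + by apply: openI => //; exact: open_interior.
  + by exists x.
  + exact: subIsetr.
  + move=> y z [/interior_subset + _] [/interior_subset + _].
    rewrite ballEmdist /= => xy xz.
    rewrite (le_trans (metric_triangle y x z))// [leRHS]splitr.
    by rewrite metric_sym lerD// ltW.
- have /nbhs_ballP[e /= e0 eU] := open_nbhs_nbhs (conj oU Ux).
  have e20 : 0 < e / 2 by rewrite divr_gt0.
  have [n ne] := natinv_lt e20.
  exists n, (interior (ball x (e / 2))); split; first exact: open_interior.
    by exists x; exact: nbhsx_ballx.
  move=> W SW [z [Wz /interior_subset]]; rewrite ballEmdist /= => xz w Ww.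
  apply: eU; rewrite ballEmdist /= (le_lt_trans (metric_triangle x z w))//.
  by rewrite [ltRHS]splitr ltrD// (le_lt_trans _ ne)//; exact: SW.
Qed.

(** * Trees of norm-small open sets in weakly compact sets *)

Section WeaklyCompact.
Variables (V : normedModType R) (X : topologicalType) (phi : X -> V).
Hypothesis cX : compact [set: X].
Hypothesis hX : hausdorff_space X.
Hypothesis wphi : continuous (phi : X -> weak_space V).
Hypothesis iphi : forall U : set X, open U ->
  exists2 W : set (weak_space V), open W & U = phi @^-1` W.

Lemma weak_nbhs_norm (W : set (weak_space V)) (v : V) :
  open W -> W v -> nbhs v (W : set V).
Proof.
move=> oW Wv; have : continuous (id : V -> weak_space V).
  by apply/weak_space_continuousP => -[g cg].
by move=> /(_ v W); apply; exact: open_nbhs_nbhs.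
Qed.

(** Fragmentation provides small open sets. Nested ones shrink to a point [x] of [U]; as weakly open
    sets are norm open, [U] contains the preimage of a norm ball around [phi x], and so every small
    enough set meeting a late [W n]. *)
Lemma weakly_compact_sequence_space :
  exists P : set (nat -> set X), boolean_isomorphic (regular_opens X)
    (regular_opens (sequence_space R P)).
Proof.
have frag n (U : set X) : open U -> U !=set0 -> exists U',
    [/\ open U', U' !=set0, U' `<=` U & norm_small phi n.+1%:R^-1 U'].
  move=> oU U0; have n0 : 0 < (n.+1%:R^-1 : R) by rewrite invr_gt0.
  apply: (weakly_compact_fragmented cX hX _ n0 oU U0) => g cg.
  exact: (iffLR (weak_space_continuousP phi) wphi (exist _ g cg)).
apply: (@dense_small_opens_sequence_space R X (fun n => norm_small phi n.+1%:R^-1)).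
  exact: frag.
move=> U oU [x0 Ux0].
have step (nW : nat * set X) : exists W', open nW.2 -> nW.2 !=set0 ->
    [/\ open W', W' !=set0, closure W' `<=` nW.2
      & norm_small phi nW.1.+1%:R^-1 W'].
  case: nW => n W /=.
  have [oW|] := pselect (open W); last by exists set0.
  have [W0|] := pselect (W !=set0); last by exists set0.
  have [W1 [oW1 W10 W1W SW1]] := frag n W oW W0.
  have [W2 [oW2 W20 W2W]] := compact_shrink cX hX oW1 W10.
  exists W2 => _ _; split => //; first exact: subset_trans W2W W1W.
  by move=> y z /subset_closure/W2W W1y /subset_closure/W2W W1z; exact: SW1.
have [next hnext] := choice step.
pose W := fix W n := if n is m.+1 then next (m, W m) else U.
have W_ok n : open (W n) /\ W n !=set0.
  elim: n => [|n [on n0]] /=; first by split => //; exists x0.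
  by have [] := hnext (n, W n) on n0.
have W_next n : closure (W n.+1) `<=` W n.
  by have [oW W0] := W_ok n; have [] := hnext (n, W n) oW W0.
have W_small n : norm_small phi n.+1%:R^-1 (W n.+1).
  by have [oW W0] := W_ok n; have [] := hnext (n, W n) oW W0.
have Wxs n : W n (xget x0 (W n)) by have [_ W0] := W_ok n; exact: (xgetPex x0 W0).
have [x [Wx _]] := compact_nested cX W_next Wxs.
have [B oB UB] := iphi oU.
have Bphix : B (phi x) by rewrite -[B _]/((phi @^-1` B) x) -UB; exact: (Wx 0%N).
have /nbhs_ballP[e /= e0 eB] := weak_nbhs_norm oB Bphix.
have [n ne] := natinv_lt (divr_gt0 e0 (ltr0Sn R 1)).
exists n, (W n.+1); split; [exact: (W_ok _).1|exact: (W_ok _).2|].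
move=> Z SZ [z [Zz Wz]] w Zw; rewrite UB; apply: eB; rewrite -ball_normE /=.
rewrite -(subrKA (phi z)) (le_lt_trans (ler_normD _ _))// [ltRHS]splitr.
apply: ltrD; apply: le_lt_trans ne; last exact: SZ.
exact: W_small (Wx n.+1) Wz.
Qed.

End WeaklyCompact.

Lemma dense_eberlein_sequence_space (X : topologicalType) :
  dense_eberlein R X -> exists (Z : topologicalType) (P : set (nat -> set Z)),
    boolean_isomorphic (regular_opens X) (regular_opens (sequence_space R P)).
Proof.
move=> [D [dD [E [S [[cE hE [V [K [_ [f [g [fK gK cf cg]]]]]] DS]]]]]].
(* The closure of [S] in [E] is compact and has the regular open algebra of [S], hence that of
   [X]. *)
pose Z := set_type (closure S); exists Z.
have XZ : boolean_isomorphic (regular_opens X) (regular_opens Z).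
  apply: boolean_isomorphic_trans (dense_regular_opens dD) _.
  apply: boolean_isomorphic_trans (homeomorphic_regular_opens DS) _.
  exact/boolean_isomorphic_sym/closure_regular_opens.
pose phi (z : Z) : V := set_val (f (set_val z)).
have [P ZP] : exists P : set (nat -> set Z), boolean_isomorphic (regular_opens Z)
    (regular_opens (sequence_space R P)).
  apply: (@weakly_compact_sequence_space V Z phi).
  - apply: compact_set_type; apply: subclosed_compact cE _ => //.
    exact: closed_closure.
  - apply: injective_hausdorff hE; first exact: set_val_continuous.
    exact: val_inj.
  - move=> z; apply: (@continuous_comp _ _ _ (f \o set_val) set_val).
      by apply: continuous_comp; [exact: set_val_continuous|exact: cf].
    exact: set_val_continuous.
  - move=> _ [U oU <-].
    have [W oW WU] : open (g @^-1` U) by move/continuousP : cg; exact.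
    exists W => //; apply/seteqP; split=> z /= Uz.
      by have : (set_val @^-1` W) (f (set_val z)) by rewrite WU /= fK.
    have : (set_val @^-1` W) (f (set_val z)) by [].
    by rewrite WU /= fK.
by exists P; exact: boolean_isomorphic_trans XZ ZP.
Qed.

Lemma metrizable_sequence_space (X : topologicalType) :
  metrizable R X -> exists (Z : topologicalType) (P : set (nat -> set Z)),
    boolean_isomorphic (regular_opens X) (regular_opens (sequence_space R P)).
Proof.
move=> [M XM]; have [P MP] := metric_sequence_space M.
exists M, P; exact: boolean_isomorphic_trans (homeomorphic_regular_opens XM) MP.
Qed.

Lemma sequence_space_metrizable0_class (X : topologicalType) :
  (exists (Z : topologicalType) (P : set (nat -> set Z)),
    boolean_isomorphic (regular_opens X) (regular_opens (sequence_space R P))) ->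
  exists2 Y, metrizable0 R Y &
    boolean_isomorphic (regular_opens X) (regular_opens Y).
Proof.
move=> [Z [P XP]]; exists (sequence_space R P) => //.
exact: sequence_space_metrizable0.
Qed.

Lemma sequence_space_eberlein0_class (X : topologicalType) :
  (exists (Z : topologicalType) (P : set (nat -> set Z)),
    boolean_isomorphic (regular_opens X) (regular_opens (sequence_space R P))) ->
  exists2 Y, eberlein_compact0 R Y &
    boolean_isomorphic (regular_opens X) (regular_opens Y).
Proof.
move=> [Z [P XP]].
exists (set_type (@path_closure R (set Z) P)).
  exact: path_closure_eberlein0.
apply: boolean_isomorphic_trans XP _; apply: boolean_isomorphic_sym.
exact: dense_embedding_regular_opens (@path_embed_dense R (set Z) P).
Qed.

Lemma eberlein_compact_compact_dense (X : topologicalType) :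
  eberlein_compact R X -> compact_dense_eberlein R X.
Proof.
move=> eX; have [cX _ _] := eX; split => //.
exists setT; split; first by move=> U U0 _; rewrite setIT.
by exists X, setT; split => //; exists id, id; split => // x; exact: cvg_id.
Qed.

End SmallOpens.

Theorem corollary6p7 (R : realType) (d : Order.disp_t)
    (A : ctbDistrLatticeType d) :
  [/\ RO_class (@metrizable R) A <-> RO_class (@compact_dense_eberlein R) A,
      RO_class (@compact_dense_eberlein R) A <-> RO_class (@dense_eberlein R) A,
      RO_class (@dense_eberlein R) A <-> RO_class (@eberlein_compact R) A,
      RO_class (@eberlein_compact R) A <-> RO_class (@eberlein_compact0 R) A
    & RO_class (@eberlein_compact0 R) A <-> RO_class (@metrizable0 R) A].
Proof.
have sub (C C' : topologicalType -> Prop) : (forall X, C X -> C' X) ->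
    RO_class C A -> RO_class C' A.
  by move=> CC' [X CX AX]; exists X => //; exact: CC'.
(* These three implications carry the content; with the inclusions of classes proved after them,
   they close all the equivalences. *)
have M_E0 : RO_class (@metrizable R) A -> RO_class (@eberlein_compact0 R) A.
  apply: RO_class_transport => X mX.
  exact/sequence_space_eberlein0_class/metrizable_sequence_space.
have S_E0 : RO_class (@dense_eberlein R) A -> RO_class (@eberlein_compact0 R) A.
  apply: RO_class_transport => X sX.
  exact/sequence_space_eberlein0_class/dense_eberlein_sequence_space.
have S_M0 : RO_class (@dense_eberlein R) A -> RO_class (@metrizable0 R) A.
  apply: RO_class_transport => X sX.
  exact/sequence_space_metrizable0_class/dense_eberlein_sequence_space.
have M0_M : RO_class (@metrizable0 R) A -> RO_class (@metrizable R) A.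
  by apply: sub => X [].
have E0_E : RO_class (@eberlein_compact0 R) A -> RO_class (@eberlein_compact R) A.
  by apply: sub => X [].
have E_CS : RO_class (@eberlein_compact R) A ->
    RO_class (@compact_dense_eberlein R) A.
  by apply: sub; exact: eberlein_compact_compact_dense.
have CS_S : RO_class (@compact_dense_eberlein R) A ->
    RO_class (@dense_eberlein R) A.
  by apply: sub => X [].
by split; split; auto.
Qed.
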